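(* Let $n\ge0$, $0\le k\le n+1$ and $\mathcal{S}\subset[1,n]$. As a chain complex, $\mathcal{B}(n,k,\mathcal{S})$ is the direct sum of the complexes $\mathbf{I}_{\mathbf{x}}\mathcal{B}(n,k,\mathcal{S})\mathbf{I}_{\mathbf{y}}$ over $\mathbf{x},\mathbf{y}\in V(n,k)$. Moreover, let $\mathbf{x},\mathbf{y}\in V(n,k)$ be not far, let $[j_1+1,j_1+l_1],\ldots,[j_b+1,j_b+l_b]$ be the generating intervals for $\mathbf{x}$ and $\mathbf{y}$, write $p_a=U_{j_a+1}\cdots U_{j_a+l_a}$, and for each $1\le a\le b$ with $[j_a+1,j_a+l_a]\cap\mathcal{S}\ne\varnothing$ choose an element $i_a\in[j_a+1,j_a+l_a]\cap\mathcal{S}$. Then an $\mathbb{F}_2$-basis of $H_*(\mathbf{I}_{\mathbf{x}}\mathcal{B}(n,k,\mathcal{S})\mathbf{I}_{\mathbf{y}})$ is given by the homology classes of the elements $$\phi\left(p\prod_{a=1}^b\left(\frac{C_{i_a}p_a}{U_{i_a}}\right)^{\varepsilon_a}\right),$$ where each $\varepsilon_a\in\{0,1\}$, with $\varepsilon_a=0$ if $\mathcal{S}\cap[j_a+1,j_a+l_a]=\varnothing$, and $p$ ranges over the monomials in the variables $U_i$, $i\in[1,n]\setminus\mathcal{S}$, that are not divisible by $p_a$ for any generating interval $[j_a+1,j_a+l_a]$.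
   Context: Notation: $[a,b]=\{a,\ldots,b\}$. $V(n,k)$ is the set of $k$-element subsets $\mathbf{x}=\{x_1<\cdots<x_k\}$ of $[0,n]$. For $\mathbf{x},\mathbf{y}\in V(n,k)$, $1\le i\le n$: $v_i(\mathbf{x},\mathbf{y})=|\mathbf{y}\cap[i,n]|-|\mathbf{x}\cap[i,n]|$, $|v|_i=|v_i|$. $\mathcal{B}_0(n,k)$ is the free $\mathbb{F}_2[U_1,\ldots,U_n]$-module on $\{f_{\mathbf{x},\mathbf{y}}\}_{\mathbf{x},\mathbf{y}\in V(n,k)}$ with $\mathbb{F}_2[U_1,\ldots,U_n]$-bilinear product $f_{\mathbf{x},\mathbf{y}}f_{\mathbf{y},\mathbf{z}}=\prod_{i}U_i^{(|v|_i(\mathbf{y},\mathbf{z})-|v|_i(\mathbf{x},\mathbf{z})+|v|_i(\mathbf{x},\mathbf{y}))/2}f_{\mathbf{x},\mathbf{z}}$ and $f_{\mathbf{x},\mathbf{y}}f_{\mathbf{y}',\mathbf{z}}=0$ for $\mathbf{y}\neq\mathbf{y}'$; $\mathbf{I}_{\mathbf{x}}=f_{\mathbf{x},\mathbf{x}}$. Put $R_i=\sum f_{\mathbf{x},(\mathbf{x}\setminus\{i-1\})\cup\{i\}}$ (over $\mathbf{x}$ with $\mathbf{x}\cap\{i-1,i\}=\{i-1\}$), $L_i=\sum f_{\mathbf{x},(\mathbf{x}\setminus\{i\})\cup\{i-1\}}$ (over $\mathbf{x}$ with $\mathbf{x}\cap\{i-1,i\}=\{i\}$), $U_i=\sum_{\mathbf{x}}U_if_{\mathbf{x},\mathbf{x}}$.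 $\mathcal{B}(n,k)$ is the quotient of $\mathcal{B}_0(n,k)$ by the two-sided ideal generated by $R_iR_{i+1}$ and $L_{i+1}L_i$ ($1\le i\le n-1$) and $\mathbf{I}_{\mathbf{x}}U_i$ for $1\le i\le n$, $\mathbf{x}\cap\{i-1,i\}=\varnothing$. $\mathcal{B}(n,k,\mathcal{S})=\mathcal{B}(n,k)[C_i\mid i\in\mathcal{S}]/(C_i^2=0)$ (the $C_i$ central), with $\mathbb{F}_2$-linear differential satisfying the Leibniz rule, zero on $\mathcal{B}(n,k)$, and $\partial(C_i)=U_i$. For a polynomial $p$ in the $U_i$ and a (square-free) monomial $c$ in the $C_i$, $i\in\mathcal{S}$, $\phi(cp)$ denotes the element $c\,p\,f_{\mathbf{x},\mathbf{y}}\in\mathbf{I}_{\mathbf{x}}\mathcal{B}(n,k,\mathcal{S})\mathbf{I}_{\mathbf{y}}$. $\mathbf{x},\mathbf{y}$ are far if $|x_a-y_a|>1$ for some $a\in[1,k]$, and not far otherwise. (When $\mathbf{x},\mathbf{y}$ are far, $\mathbf{I}_{\mathbf{x}}\mathcal{B}(n,k,\mathcal{S})\mathbf{I}_{\mathbf{y}}=0$, by a result of Ozsváth–Szabó.) A coordinate $t\in[0,n]$ is fully used if $t\in\mathbf{x}\cap\mathbf{y}$. For $\mathbf{x},\mathbf{y}$ not far, a generating interval for $\mathbf{x}$ and $\mathbf{y}$ is an interval $[j+1,j+l]$ with $l\ge1$ and $j,j+l\in[0,n]$ such that $j$ and $j+l$ are not fully used, every $t$ with $j<t<j+l$ is fully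 used, and $v_i(\mathbf{x},\mathbf{y})=0$ for all $i\in[j+1,j+l]$. *)

(* Defs.v *)
(* Index conventions: a line i in [1, n] is represented by the ordinal i - 1
   of type 'I_n, and a coordinate in [0, n] by an ordinal of type 'I_n.+1; thus
   the line i : 'I_n lies between the coordinates i and i.+1. *)
From HB Require Import structures.
From mathcomp Require Import all_boot all_order all_algebra.
From mathcomp Require Import mpoly.
From mathcomp Require Import zify ring.
From mathcomp Require Import boolp.

Set Implicit Arguments.
Unset Strict Implicit.
Unset Printing Implicit Defensive.

Import GRing.Theory Num.Theory.
Local Open Scope ring_scope.
Local Open Scope quotient_scope.

Section F2.
Variables V W : lmodType 'F_2.

Lemma F2_scale (c : 'F_2) (v : V) : c *: v = v *+ (c : nat).
Proof. by rewrite -[in LHS](natr_Zp c) scaler_nat. Qed.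

Lemma F2_addrr (v : V) : v + v = 0.
Proof. by rewrite -mulr2n -scaler_nat (_ : 2%:R = 0 :> 'F_2) ?scale0r //; apply/val_inj. Qed.

End F2.

Lemma F2_scalable (V W : lmodType 'F_2) (f : V -> W) :
  zmod_morphism f -> scalable f.
Proof.
move=> fB c v; rewrite !F2_scale.
have f0 : f 0 = 0 by rewrite -(subrr 0) fB subrr.
have fN u : f (- u) = - f u by rewrite -[- u]sub0r fB f0 sub0r.
elim: (c : nat) => [|m IH]; first by rewrite !mulr0n.
by rewrite !mulrS -[v *+ m]opprK fB fN IH opprK.
Qed.

Lemma F2_submod_closed (V : lmodType 'F_2) (P : {pred V}) :
  0 \in P -> {in P &, forall u v, u + v \in P} -> submod_closed P.
Proof.
move=> P0 PD; split=> // c u v Pu Pv; apply: (PD) => //.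
by rewrite F2_scale; elim: (c : nat) => [|m IH]; rewrite ?mulr0n ?mulrS ?PD.
Qed.

Section LQuot.
Variables (K : nzRingType) (V : lmodType K) (P : submodClosed V).

(* submodClosed does not inherit from zmodClosed, which quotients require. *)
Definition lmem : {pred V} := fun v => v \in P.

Fact lmem_zmod_closed : zmod_closed lmem.
Proof.
split=> [|u v Pu Pv]; first exact: (rpred0 P).
suff: u - v \in P by []; by rewrite rpredD // -scaleN1r rpredZ.
Qed.
HB.instance Definition _ := GRing.isZmodClosed.Build V lmem lmem_zmod_closed.

Definition lquot : Type := {ideal_quot lmem}.

HB.instance Definition _ := GRing.Zmodule.copy lquot {ideal_quot lmem}.

Local Notation Q := lquot.

Definition lpi (v : V) : Q := \pi_{ideal_quot lmem} v.

Lemma lpiB : zmod_morphism lpi.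
Proof. exact: pi_is_zmod_morphism. Qed.

HB.instance Definition _ := GRing.isZmodMorphism.Build V Q lpi lpiB.

Lemma lpi_eq (u v : V) : (lpi u == lpi v) = (u - v \in P).
Proof. by rewrite /lpi -Quotient.idealrBE. Qed.

Lemma lpi_eq0 (u : V) : (lpi u == 0) = (u \in P).
Proof. by rewrite -(raddf0 lpi) lpi_eq subr0. Qed.

Definition lrepr (q : Q) : V := repr (q : {ideal_quot lmem}).

Lemma lreprK : cancel lrepr lpi.
Proof. by move=> q; rewrite /lpi /lrepr reprK. Qed.

Definition lscale (c : K) (q : Q) : Q := lpi (c *: lrepr q).

Lemma lpi_scale c v : lpi (c *: v) = lscale c (lpi v).
Proof.
apply/eqP; rewrite lpi_eq -scalerBr rpredZ // -lpi_eq.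
by rewrite lreprK.
Qed.

Fact lscaleA a b q : lscale a (lscale b q) = lscale (a * b) q.
Proof. by rewrite -[q]lreprK -!lpi_scale scalerA. Qed.
Fact lscale1 : left_id 1 lscale.
Proof. by move=> q; rewrite -[q]lreprK -!lpi_scale scale1r. Qed.
Fact lscaleDr : right_distributive lscale +%R.
Proof.
by move=> c p q; rewrite -[p]lreprK -[q]lreprK -raddfD -!lpi_scale scalerDr raddfD.
Qed.
Fact lscaleDl q : {morph lscale^~ q : a b / a + b}.
Proof. by move=> a b; rewrite -[q]lreprK -!lpi_scale scalerDl raddfD. Qed.

HB.instance Definition _ :=
  GRing.Zmodule_isLmodule.Build K Q lscaleA lscale1 lscaleDr lscaleDl.

Lemma lpi_scalable : scalable lpi.
Proof. exact: lpi_scale. Qed.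

HB.instance Definition _ := GRing.isScalable.Build K V Q *:%R lpi lpi_scalable.

End LQuot.

Definition is_basis (K : nzRingType) (V : lmodType K) (I : eqType)
    (P : pred I) (e : I -> V) : Prop :=
  (forall v, exists2 s : seq I, all P s &
     exists c : I -> K, v = \sum_(i <- s) c i *: e i) /\
  (forall (s : seq I) (c : I -> K), uniq s -> all P s ->
     \sum_(i <- s) c i *: e i = 0 -> forall i, i \in s -> c i = 0).

Section Complex.
Variables (K : nzRingType) (V : lmodType K) (d : {linear V -> V}).

Definition direct_sum_complex (I : finType) (C : I -> submodClosed V) : Prop :=
  (forall i a, a \in C i -> d a \in C i) /\
  (forall a, exists! f : {ffun I -> V},
     (forall i, f i \in C i) /\ a = \sum_i f i).

(* Homology (ungraded) of the subcomplex C: cycles of C modulo d C. *)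
Variable C : submodClosed V.

Definition cycles : {pred V} := fun a => (a \in C) && (d a == 0).

Fact cycles_closed : submod_closed cycles.
Proof.
have cE v : (v \in cycles) = (v \in C) && (d v == 0) by [].
split=> [|c u v]; rewrite !cE ?rpred0 ?raddf0 ?eqxx //.
case/andP=> Cu /eqP du /andP[Cv /eqP dv]; by rewrite rpredD ?rpredZ //= linearP du dv scaler0 addr0 eqxx.
Qed.
HB.instance Definition _ := GRing.isSubmodClosed.Build K V cycles cycles_closed.

Record cycle := Cycle {cycle_val : V; cycle_valP : cycle_val \in cycles}.
HB.instance Definition _ := [isSub for cycle_val].
HB.instance Definition _ := [Choice of cycle by <:].
HB.instance Definition _ := [SubChoice_isSubLmodule of cycle by <:].

Definition boundaries : {pred cycle} :=
  fun z => `[< exists2 w, w \in C & val z = d w >].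

Fact boundaries_closed : submod_closed boundaries.
Proof.
split=> [|c u v].
  by apply/asboolP; exists 0; rewrite ?rpred0 ?raddf0.
move=> /asboolP[u' Cu du] /asboolP[v' Cv dv]; apply/asboolP.
exists (c *: u' + v'); first by rewrite rpredD ?rpredZ.
by rewrite linearP -du -dv -linearP.
Qed.
HB.instance Definition _ :=
  GRing.isSubmodClosed.Build K cycle boundaries boundaries_closed.

Definition homology : lmodType K := lquot boundaries.

(* Only meaningful on cycles of C; elsewhere it is the class of 0. *)
Definition hclass (a : V) : homology := lpi boundaries (insubd (0 : cycle) a).

End Complex.

(* The ring A[C_j | j in J] / (C_j ^ 2) with central variables C_j: a T is the
   coefficient of the square-free monomial \prod_(j in T) C_j. *)
Definition sqz (A : Type) (J : finType) : Type := {ffun {set J} -> A}.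


Section Sqz.
Variable J : finType.
HB.instance Definition _ (A : choiceType) :=
  Choice.copy (sqz A J) {ffun {set J} -> A}.
HB.instance Definition _ (A : zmodType) :=
  GRing.Zmodule.copy (sqz A J) {ffun {set J} -> A}.
HB.instance Definition _ (K : pzRingType) (A : lmodType K) :=
  GRing.Lmodule.copy (sqz A J) {ffun {set J} -> A}.

Variable A : pzRingType.
Implicit Types (a b c : sqz A J) (T P Q : {set J}) (u : A) (j : J).

Definition sqz_mon u T : sqz A J := [ffun T' => if T' == T then u else 0].
Definition sqz_cst u : sqz A J := sqz_mon u set0.
Definition sqz_var j : sqz A J := sqz_mon 1 [set j].

Definition sqz_mul a b : sqz A J :=
  [ffun T : {set J} => \sum_(P : {set J} | P \subset T) a P * b (T :\: P)].

Fact sqz_mulA : associative sqz_mul.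
Proof.
move=> a b c; apply/ffunP=> T; rewrite !ffunE.
under eq_bigr => P _ do rewrite ffunE big_distrr /=.
under [RHS]eq_bigr => P _ do rewrite ffunE big_distrl /=.
rewrite [RHS](exchange_big_dep (fun Q => Q \subset T)) /=; last first.
  by move=> P Q PT QP; apply: subset_trans PT.
apply: eq_bigr => Q QT.
rewrite [RHS](reindex_onto (fun R => Q :|: R) (fun P => P :\: Q)) /=; last first.
  by move=> P /andP[_ QP]; rewrite setDE setUIr setUCr setIT; apply/setUidPr.
have UDK R : ((Q :|: R) :\: Q == R) = [disjoint R & Q].
  by rewrite setDUl setDv set0U; apply/eqP/setDidPl.
apply: eq_big => [R|R].
  by rewrite subUset QT subsetUl andbT /= subsetD UDK.
rewrite subsetD -UDK => /andP[_ /eqP UDR].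
by rewrite mulrA UDR setDDl.
Qed.

Fact sqz_mul1l : left_id (sqz_cst 1) sqz_mul.
Proof.
move=> a; apply/ffunP=> T; rewrite ffunE (bigD1 set0) ?sub0set //= ffunE eqxx.
rewrite mul1r setD0 big1 ?addr0 // => P /andP[_ /negbTE P0].
by rewrite ffunE P0 mul0r.
Qed.

Fact sqz_mul1r : right_id (sqz_cst 1) sqz_mul.
Proof.
move=> a; apply/ffunP=> T; rewrite ffunE (bigD1 T) //= ffunE setDv eqxx mulr1.
rewrite big1 ?addr0 // => P /andP[PT nPT]; rewrite ffunE ifF ?mulr0 //.
by apply: contraNF nPT => /eqP/eqP; rewrite setD_eq0 eqEsubset PT.
Qed.

Fact sqz_mulDl : left_distributive sqz_mul +%R.
Proof.
move=> a b c; apply/ffunP=> T; rewrite !ffunE -big_split.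
by apply: eq_bigr => P _; rewrite ffunE mulrDl.
Qed.

Fact sqz_mulDr : right_distributive sqz_mul +%R.
Proof.
move=> a b c; apply/ffunP=> T; rewrite !ffunE -big_split.
by apply: eq_bigr => P _; rewrite ffunE mulrDr.
Qed.

HB.instance Definition _ := GRing.Zmodule_isPzRing.Build (sqz A J)
  sqz_mulA sqz_mul1l sqz_mul1r sqz_mulDl sqz_mulDr.

Lemma sqz_mulE a b T :
  (a * b) T = \sum_(P : {set J} | P \subset T) a P * b (T :\: P).
Proof. by rewrite ffunE. Qed.

Lemma sqz_cstM : {morph sqz_cst : u v / u * v}.
Proof.
move=> u v; apply/ffunP=> T; rewrite !ffunE (bigD1 set0) ?sub0set //= setD0.
rewrite !ffunE eqxx big1 ?addr0; first by case: eqP; rewrite ?mulr0.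
by move=> P /andP[_ /negbTE P0]; rewrite ffunE P0 mul0r.
Qed.

Lemma sqz_varE j a : sqz_var j * a =
  [ffun T : {set J} => if j \in T then a (T :\ j) else 0].
Proof.
apply/ffunP=> T; rewrite !ffunE; case: ifP => jT; last first.
  apply: big1 => P PT; rewrite ffunE ifF ?mul0r //.
  by apply: contraFF jT => /eqP Pj; rewrite -sub1set -Pj.
rewrite (bigD1 [set j]) ?sub1set //= ffunE eqxx mul1r big1 ?addr0 //.
by move=> P /andP[_ /negbTE Pj]; rewrite ffunE Pj mul0r.
Qed.

Lemma sqz_var_central j a : sqz_var j * a = a * sqz_var j.
Proof.
rewrite sqz_varE; apply/ffunP=> T; rewrite !ffunE; case: ifP => jT; last first.
  rewrite big1 // => P PT; rewrite ffunE ifF ?mulr0 //.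
  by apply: contraFF jT => /eqP Pj; have := subsetDl T P; rewrite Pj sub1set.
rewrite (bigD1 (T :\ j)) ?subsetDl //= ffunE ifT ?mulr1; last first.
  by rewrite setDDr setDv set0U; apply/eqP/setIidPr; rewrite sub1set.
rewrite big1 ?addr0 // => P /andP[PT nP]; rewrite ffunE ifF ?mulr0 //.
apply: contraNF nP => /eqP <-.
by rewrite setDDr setDv set0U; apply/eqP/esym/setIidPr.
Qed.

Lemma sqz_var_sqr j : sqz_var j * sqz_var j = 0.
Proof.
rewrite sqz_varE; apply/ffunP=> T; rewrite !ffunE; case: ifP => // _.
by rewrite ifF //; apply/eqP=> /setP/(_ j); rewrite !inE eqxx.
Qed.

End Sqz.

Fact sqz_mulC (A : comPzRingType) (J : finType) : commutative (@sqz_mul J A).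
Proof.
move=> a b; apply/ffunP=> T; rewrite !ffunE.
have DDK (P : {set J}) : (P \subset T) = (T :\: (T :\: P) == P).
  by rewrite setDDr setDv set0U; apply/setIidPr/eqP.
rewrite (reindex_onto (setD T) (setD T)) /= => [|P]; last by rewrite DDK => /eqP.
apply: eq_big => [P|P /andP[_ /eqP ->]]; last exact: mulrC.
by rewrite subsetDl DDK.
Qed.

HB.instance Definition _ (A : comPzRingType) (J : finType) :=
  GRing.PzRing_hasCommutativeMul.Build (sqz A J) (@sqz_mulC A J).

Section SqzDifferential.
Variables (A : pzRingType) (J : finType) (u : J -> A).
Hypothesis u_central : forall j a, a * u j = u j * a.
Hypothesis A_char2 : forall a : A, a + a = 0.

(* d (a * \prod_(j in T) C_j) = \sum_(j in T) a * u j * \prod_(i in T | i != j) C_i *)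
Definition sqz_diff (a : sqz A J) : sqz A J :=
  [ffun T : {set J} => \sum_(j | j \notin T) a (j |: T) * u j].

Lemma sqz_diffB : zmod_morphism sqz_diff.
Proof.
move=> a b; apply/ffunP=> T; rewrite !ffunE -sumrB.
by apply: eq_bigr => j _; rewrite !ffunE mulrBl.
Qed.

Lemma sqz_diff_cst v : sqz_diff (sqz_cst J v) = 0.
Proof.
apply/ffunP=> T; rewrite !ffunE big1 // => j _; rewrite ffunE ifF ?mul0r //.
by apply/eqP=> /setP/(_ j); rewrite !inE eqxx.
Qed.

Lemma sqz_diff_var j : sqz_diff (sqz_var A j) = sqz_cst J (u j).
Proof.
apply/ffunP=> T; rewrite !ffunE; case: eqP => [->|/eqP T0].
  rewrite (bigD1 j) ?inE //= ffunE setU0 eqxx mul1r big1 ?addr0 //.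
  by move=> i /andP[_ /negbTE ij]; rewrite ffunE setU0 (inj_eq set1_inj) ij mul0r.
rewrite big1 // => i iT; rewrite ffunE ifF ?mul0r //; apply/eqP => iTj.
case/set0Pn: T0 => t tT.
have /set1P tj : t \in [set j] by rewrite -iTj !inE tT orbT.
have /set1P ij : i \in [set j] by rewrite -iTj !inE eqxx.
by rewrite ij -tj tT in iT.
Qed.

Let reindexU1 (j : J) (T : {set J}) (F : {set J} -> A) : j \notin T ->
  \sum_(P : {set J} | (P \subset j |: T) && (j \in P)) F P =
  \sum_(P : {set J} | P \subset T) F (j |: P).
Proof.
move=> jT; rewrite (reindex_onto (fun P => j |: P) (fun P => P :\ j)) /=.
  apply: eq_bigl => P; rewrite setU11 andbT subUset sub1set setU11 /=.
  apply/andP/idP => [[PT /eqP jP]|PT]; last first.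
    split; first exact: subset_trans PT (subsetUr _ _).
    by rewrite setU1K //; apply: contraNN jT; apply: (subsetP PT).
  apply/subsetP=> t tP; have := subsetP PT t tP; rewrite !inE => /orP[/eqP tj|//].
  by move: tP; rewrite -jP tj !inE eqxx.
by move=> P /andP[_ jP]; rewrite setD1K.
Qed.

Let reindexN1 (j : J) (T : {set J}) (F : {set J} -> A) : j \notin T ->
  \sum_(P : {set J} | (P \subset j |: T) && (j \notin P)) F P =
  \sum_(P : {set J} | P \subset T) F P.
Proof.
move=> jT; apply: eq_bigl => P; apply/andP/idP => [[PT jP]|PT].
  apply/subsetP=> t tP; have := subsetP PT t tP; rewrite !inE => /orP[/eqP tj|//].
  by rewrite -tj tP in jP.
split; first exact: subset_trans PT (subsetUr _ _).
by apply: contraNN jT; apply: (subsetP PT).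
Qed.

Lemma sqz_diffM a b : sqz_diff (a * b) = sqz_diff a * b + a * sqz_diff b.
Proof.
apply/ffunP=> T; rewrite !ffunE.
pose F j (P : {set J}) := a (j |: P) * b (T :\: P) * u j.
pose G j (P : {set J}) := a P * b (j |: (T :\: P)) * u j.
transitivity (\sum_(j | j \notin T) \sum_(P : {set J} | P \subset T) F j P +
              \sum_(j | j \notin T) \sum_(P : {set J} | P \subset T) G j P).
  rewrite -big_split; apply: eq_bigr => j jT /=.
  rewrite sqz_mulE big_distrl (bigID (fun P : {set J} => j \in P)) /=.
  rewrite reindexU1 // reindexN1 //; congr (_ + _); apply: eq_bigr => P PT.
    by congr (a _ * b _ * _); apply/setP=> t; rewrite !inE; case: eqP => // ->; rewrite (negbTE jT) andbF.
  have jP : j \notin P by apply: contraNN jT; apply: (subsetP PT).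
  by congr (a _ * b _ * _); apply/setP=> t; rewrite !inE; case: eqP => // ->; rewrite jP.
pose E := \sum_(j | j \in T) \sum_(P : {set J} | (P \subset T) && (j \notin P)) F j P.
have -> : \sum_(P : {set J} | P \subset T) sqz_diff a P * b (T :\: P) =
    \sum_(j | j \notin T) \sum_(P : {set J} | P \subset T) F j P + E.
  rewrite [E](exchange_big_dep (fun P : {set J} => P \subset T)) /=; last first.
    by move=> j P _ /andP[].
  rewrite [X in X + _]exchange_big -big_split; apply: eq_bigr => P PT /=.
  rewrite ffunE big_distrl (bigID (mem T)) [LHS]addrC /=; congr (_ + _).
    apply: eq_big => [j|j _]; last by rewrite /F -!mulrA u_central.
    by apply: andb_idl; apply: contraNN; apply: (subsetP PT).
  by apply: eq_big => [j|j _]; [rewrite PT andbC | rewrite /F -!mulrA u_central].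
have -> : \sum_(P : {set J} | P \subset T) a P * sqz_diff b (T :\: P) =
    \sum_(j | j \notin T) \sum_(P : {set J} | P \subset T) G j P + E.
  have -> : E = \sum_(j | j \in T)
      \sum_(P : {set J} | (P \subset T) && (j \in P)) G j P.
    apply: eq_bigr => j jT; rewrite -(setD1K jT) reindexU1 ?setD11 //.
    rewrite reindexN1 ?setD11 //; apply: eq_bigr => P PT; rewrite /F /G.
    congr (_ * b _ * _); apply/setP=> t; rewrite !inE.
    case: eqP => [->|//]; rewrite jT andbT.
    by apply/negP => /(subsetP PT); rewrite !inE eqxx.
  rewrite [X in _ + X](exchange_big_dep (fun P : {set J} => P \subset T)) /=; last first.
    by move=> j P _ /andP[].
  rewrite [X in X + _]exchange_big -big_split; apply: eq_bigr => P PT /=.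
  rewrite ffunE big_distrr (bigID (mem T)) [LHS]addrC /=; congr (_ + _).
    apply: eq_big => [j|j _]; last by rewrite /G mulrA.
    by rewrite !inE; case: (j \in T); rewrite ?andbF.
  apply: eq_big => [j|j _]; last by rewrite /G mulrA.
  by rewrite !inE PT; case: (j \in T); rewrite ?andbF // negb_and negbK andbT orbF.
by rewrite addrACA A_char2 addr0.
Qed.

(* sqz_diff is the only derivation that vanishes on A and maps C_j to u j. *)
Lemma sqz_diff_unique (D : sqz A J -> sqz A J) :
    {morph D : a b / a + b} ->
    (forall a b, D (a * b) = D a * b + a * D b) ->
    (forall v, D (sqz_cst J v) = 0) ->
    (forall j, D (sqz_var A j) = sqz_cst J (u j)) ->
  D =1 sqz_diff.
Proof.
move=> DD DM Dc Dv a.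
have D0 : D 0 = 0 by apply: (@addrI _ (D 0)); rewrite -DD !addr0.
have dD : {morph sqz_diff : a b / a + b}.
  move=> b c; apply/ffunP=> T; rewrite !ffunE -big_split.
  by apply: eq_bigr => j _; rewrite !ffunE mulrDl.
have d0 : sqz_diff 0 = 0.
  by apply: (@addrI _ (sqz_diff 0)); rewrite -dD !addr0.
have -> : a = \sum_T sqz_mon (a T) T.
  apply/ffunP=> T; rewrite sum_ffunE (bigD1 T) //= ffunE eqxx big1 ?addr0 //.
  by move=> P /negbTE PT; rewrite ffunE eq_sym PT.
rewrite (big_morph D DD D0) (big_morph _ dD d0); apply: eq_bigr => T _.
elim: {T}#|T| {-2}T (erefl #|T|) (a T) => [|m IH] T Tm v.
  by move/eqP: Tm; rewrite cards_eq0 => /eqP ->; rewrite Dc sqz_diff_cst.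
have /card_gt0P[j jT] : (0 < #|T|)%N by rewrite Tm.
have -> : sqz_mon v T = sqz_var A j * sqz_mon v (T :\ j).
  rewrite sqz_varE; apply/ffunP=> P; rewrite !ffunE.
  case: (P =P T) => [->|PT]; first by rewrite jT eqxx.
  case: ifP => // jP; rewrite ifF //; apply/eqP=> PTj.
  by apply: PT; rewrite -(setD1K jP) PTj setD1K.
rewrite DM sqz_diffM Dv sqz_diff_var IH //.
by move: Tm; rewrite (cardsD1 j) jT => -[].
Qed.

Lemma sqz_diffK a : sqz_diff (sqz_diff a) = 0.
Proof.
apply/ffunP=> T; rewrite !ffunE.
pose F j i := a (i |: (j |: T)) * u i * u j.
pose r (j : J) := nat_of_ord (enum_rank j).
have FC i j : F i j = F j i by rewrite /F -!mulrA (u_central i) setUCA.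
have rE i j : (i == j) = (r i == r j).
  by rewrite (inj_eq val_inj) (inj_eq enum_rank_inj).
transitivity (\sum_(j | j \notin T) \sum_(i | (i \notin T) && (r i < r j)%N) F j i +
              \sum_(j | j \notin T) \sum_(i | (i \notin T) && (r j < r i)%N) F j i).
  rewrite -big_split; apply: eq_bigr => j jT /=.
  rewrite ffunE big_distrl (bigID (fun i => r i < r j)%N) /=.
  by congr (_ + _); apply: eq_bigl => i; rewrite !inE negb_or rE;
    case: ltngtP; rewrite ?andbT ?andbF.
rewrite [X in _ + X](exchange_big_dep (fun i => i \notin T)) /=; last first.
  by move=> j i _ /andP[].
have -> : \sum_(i | i \notin T) \sum_(j | (j \notin T) && ((i \notin T) && (r j < r i)%N)) F j i =
   \sum_(i | i \notin T) \sum_(j | (j \notin T) && (r j < r i)%N) F i j.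
  by apply: eq_bigr => i iT; apply: eq_big => [j|j _]; rewrite ?iT // FC.
by rewrite A_char2.
Qed.

End SqzDifferential.

Inductive ideal (A : pzRingType) (G : A -> Prop) : A -> Prop :=
| ideal_gen a g b of G g : ideal G (a * g * b)
| ideal_0 : ideal G 0
| ideal_D a b of ideal G a & ideal G b : ideal G (a + b).

Lemma ideal_mull (A : pzRingType) (G : A -> Prop) c a :
  ideal G a -> ideal G (c * a).
Proof.
elim=> {a} [a g b Gg||a b _ IHa _ IHb]; last by rewrite mulrDr; apply: ideal_D.
  by rewrite !mulrA; apply: ideal_gen.
by rewrite mulr0; apply: ideal_0.
Qed.

Lemma ideal_mulr (A : pzRingType) (G : A -> Prop) c a :
  ideal G a -> ideal G (a * c).
Proof.
elim=> {a} [a g b Gg||a b _ IHa _ IHb]; last by rewrite mulrDl; apply: ideal_D.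
  by rewrite -mulrA; apply: ideal_gen.
by rewrite mul0r; apply: ideal_0.
Qed.

Notation vert n k := {x : {set 'I_n.+1} | #|x| == k}.

Section Vertices.
Variables n k : nat.
Implicit Types x y z w : vert n k.

Definition vdiff x y (i : nat) : int :=
  #|[set t in val y | (i <= t)%N]|%:Z - #|[set t in val x | (i <= t)%N]|%:Z.

(* The increasing sequence x_1 < ... < x_k, see coords_sorted. *)
Definition coords x : seq nat := [seq val t | t <- enum (val x)].

Lemma coords_sorted x : sorted ltn (coords x).
Proof.
rewrite /coords sorted_map; apply: (@sorted_filter _ (relpre val ltn)).
  by move=> a b c; apply: ltn_trans.
by rewrite -sorted_map -enumT val_enum_ord iota_ltn_sorted.
Qed.

Lemma size_coords x : size (coords x) = k.
Proof. by rewrite size_map -cardE; apply/eqP/(valP x). Qed.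

Definition far x y : bool :=
  [exists a : 'I_k,
     1 < `|(nth 0%N (coords x) a)%:Z - (nth 0%N (coords y) a)%:Z|].

Definition fully_used x y : {set 'I_n.+1} := val x :&: val y.

(* g = (j, m) stands for the interval [j + 1, m] of lines. *)
Definition lines (g : 'I_n.+1 * 'I_n.+1) : {set 'I_n} :=
  [set i : 'I_n | (g.1 <= i)%N && (i < g.2)%N].

(* The exponents of p_a = \prod_(i in lines g) U_i. *)
Definition pmon (g : 'I_n.+1 * 'I_n.+1) : 'X_{1..n} :=
  [multinom (i \in lines g : nat) | i < n].

Definition generating x y (g : 'I_n.+1 * 'I_n.+1) : bool :=
  [&& (g.1 < g.2)%N, g.1 \notin fully_used x y, g.2 \notin fully_used x y,
      [forall t : 'I_n.+1, (g.1 < t < g.2)%N ==> (t \in fully_used x y)]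
    & [forall i in lines g, vdiff x y i.+1 == 0]].

(* The exponent of U_i in f_{x,y} f_{y,z}: a natural number, see mulexpE. *)
Definition mulexp x y z (i : nat) : nat :=
  ((`|vdiff y z i| + `|vdiff x y i| - `|vdiff x z i|)./2)%N.

Lemma mulexpE x y z i :
  ((mulexp x y z i).*2%:Z = `|vdiff y z i| - `|vdiff x z i| + `|vdiff x y i|)%R.
Proof. rewrite /mulexp /vdiff; lia. Qed.

Lemma mulexpA x y z w i :
  (mulexp x y z i + mulexp x z w i = mulexp y z w i + mulexp x y w i)%N.
Proof. rewrite /mulexp /vdiff; lia. Qed.

Lemma mulexp1l x y i : mulexp x x y i = 0%N.
Proof. rewrite /mulexp /vdiff; lia. Qed.

Lemma mulexp1r x y i : mulexp x y y i = 0%N.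
Proof. rewrite /mulexp /vdiff; lia. Qed.

End Vertices.

(* a (x, y) is the coefficient of f_{x,y}. *)
Definition B0 (n k : nat) : Type :=
  {ffun vert n k * vert n k -> {mpoly 'F_2[n]}}.

Section B0.
Variables n k : nat.
Implicit Types (x y z : vert n k) (a b c : B0 n k) (p q : {mpoly 'F_2[n]}).

HB.instance Definition _ :=
  GRing.Lmodule.copy (B0 n k) {ffun vert n k * vert n k -> {mpoly 'F_2[n]}}.

Definition mulmon x y z : {mpoly 'F_2[n]} :=
  \prod_(i < n) 'X_i ^+ mulexp x y z i.+1.

(* The element p f_{x,y}. *)
Definition fel p x y : B0 n k := [ffun xy => if xy == (x, y) then p else 0].

Definition B0_one : B0 n k := \sum_x fel 1 x x.

Definition B0_mul a b : B0 n k :=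
  [ffun xz : vert n k * vert n k =>
     \sum_y mulmon xz.1 y xz.2 * a (xz.1, y) * b (y, xz.2)].

Lemma mulmonA x y z w :
  mulmon x y z * mulmon x z w = mulmon y z w * mulmon x y w.
Proof.
rewrite -!big_split; apply: eq_bigr => i _ /=.
by rewrite -!exprD mulexpA.
Qed.

Lemma mulmon1l x y : mulmon x x y = 1.
Proof. by apply: big1 => i _; rewrite mulexp1l. Qed.

Lemma mulmon1r x y : mulmon x y y = 1.
Proof. by apply: big1 => i _; rewrite mulexp1r. Qed.

Fact B0_mulA : associative B0_mul.
Proof.
move=> a b c; apply/ffunP=> -[x w]; rewrite !ffunE /=.
under eq_bigr => y _ do rewrite ffunE big_distrr /=.
under [RHS]eq_bigr => y _ do rewrite ffunE big_distrr big_distrl /=.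
rewrite exchange_big; apply: eq_bigr => z _; apply: eq_bigr => y _ /=.
have := mulmonA x y z w; move: (mulmon x y w) (mulmon y z w) (mulmon x z w).
move: (mulmon x y z) (a _) (b _) (c _) => m p q r m1 m2 m3 E; ring: E.
Qed.

Lemma B0_oneE x y : B0_one (x, y) = (x == y)%:R.
Proof.
rewrite sum_ffunE; under eq_bigr => z _ do rewrite ffunE xpair_eqE.
rewrite (bigD1 x) //= eqxx /= eq_sym big1 ?addr0; first by case: eqP.
by move=> z /negbTE zx; rewrite eq_sym zx.
Qed.

Fact B0_mul1l : left_id B0_one B0_mul.
Proof.
move=> a; apply/ffunP=> -[x y]; rewrite !ffunE /= (bigD1 x) //= B0_oneE eqxx.
rewrite mulmon1l !mul1r big1 ?addr0 // => z zx.
by rewrite B0_oneE eq_sym (negbTE zx) mulr0 mul0r.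
Qed.

Fact B0_mul1r : right_id B0_one B0_mul.
Proof.
move=> a; apply/ffunP=> -[x y]; rewrite !ffunE /= (bigD1 y) //= B0_oneE eqxx.
rewrite mulmon1r mul1r mulr1 big1 ?addr0 // => z zy.
by rewrite B0_oneE (negbTE zy) mulr0.
Qed.

Fact B0_mulDl : left_distributive B0_mul +%R.
Proof.
move=> a b c; apply/ffunP=> -[x y]; rewrite !ffunE -big_split.
by apply: eq_bigr => z _; rewrite ffunE mulrDr mulrDl.
Qed.

Fact B0_mulDr : right_distributive B0_mul +%R.
Proof.
move=> a b c; apply/ffunP=> -[x y]; rewrite !ffunE -big_split.
by apply: eq_bigr => z _; rewrite ffunE mulrDr.
Qed.

HB.instance Definition _ := GRing.Zmodule_isPzRing.Build (B0 n k)
  B0_mulA B0_mul1l B0_mul1r B0_mulDl B0_mulDr.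

Lemma fel_mul p q x y z : fel p x y * fel q y z = fel (mulmon x y z * p * q) x z.
Proof.
apply/ffunP=> -[x' z']; rewrite !ffunE /= (bigD1 y) //= !ffunE.
rewrite !xpair_eqE eqxx andbT /= big1 ?addr0; last first.
  by move=> y' /negbTE y'y; rewrite ffunE xpair_eqE y'y andbF mulr0 mul0r.
by case: eqP => [->|_]; case: eqP => [->|_]; rewrite ?mulr0 ?mul0r.
Qed.

Lemma fel_mul0 p q x y y' z : y != y' -> fel p x y * fel q y' z = 0.
Proof.
move=> yy'; apply/ffunP=> -[x' z']; rewrite !ffunE big1 //= => y'' _.
rewrite !ffunE !xpair_eqE; case: (y'' =P y) => [->|_]; last first.
  by rewrite andbF mulr0 mul0r.
by rewrite (negbTE yy') mulr0.
Qed.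

(* lft i and rgt i are the coordinates i - 1 and i adjacent to the line i. *)
Definition lft (i : 'I_n) : 'I_n.+1 := widen_ord (leqnSn n) i.
Definition rgt (i : 'I_n) : 'I_n.+1 := lift ord0 i.

Definition Rel (i : 'I_n) : B0 n k :=
  \sum_(x : vert n k) \sum_(y : vert n k | [&& lft i \in val x, rgt i \notin val x
                     & val y == rgt i |: (val x :\ lft i)]) fel 1 x y.

Definition Lel (i : 'I_n) : B0 n k :=
  \sum_(x : vert n k) \sum_(y : vert n k | [&& rgt i \in val x, lft i \notin val x
                     & val y == lft i |: (val x :\ rgt i)]) fel 1 x y.

Definition Uel (i : 'I_n) : B0 n k := \sum_x fel 'X_i x x.

Lemma UelE i x y : Uel i (x, y) = if x == y then 'X_i else 0.
Proof.
rewrite sum_ffunE; under eq_bigr => z _ do rewrite ffunE xpair_eqE.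
rewrite (bigD1 x) //= eqxx /= eq_sym big1 ?addr0 //.
by move=> z /negbTE zx; rewrite eq_sym zx.
Qed.

Lemma Uel_central i a : a * Uel i = Uel i * a.
Proof.
apply/ffunP=> -[x z]; rewrite !ffunE /= (bigD1 z) //= [RHS](bigD1 x) //=.
rewrite !UelE !eqxx mulmon1l mulmon1r !mul1r mulrC; congr (_ + _).
rewrite !big1 // => y /negbTE yx; rewrite UelE; first by rewrite eq_sym yx mulr0 mul0r.
by rewrite yx mulr0.
Qed.

Inductive Brel : B0 n k -> Prop :=
| Brel_RR (i j : 'I_n) of j = i.+1 :> nat : Brel (Rel i * Rel j)
| Brel_LL (i j : 'I_n) of j = i.+1 :> nat : Brel (Lel j * Lel i)
| Brel_U x (i : 'I_n) of lft i \notin val x & rgt i \notin val x :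
    Brel (fel 1 x x * Uel i).

Definition Bideal : {pred B0 n k} := fun a => `[< ideal Brel a >].

Fact Bideal_closed : submod_closed Bideal.
Proof.
apply: F2_submod_closed => [|a b]; rewrite !unfold_in.
  by apply/asboolP/ideal_0.
by move=> /asboolP Ia /asboolP Ib; apply/asboolP/ideal_D.
Qed.
HB.instance Definition _ :=
  GRing.isSubmodClosed.Build 'F_2 (B0 n k) Bideal Bideal_closed.

End B0.

Definition B (n k : nat) : Type := lquot (@Bideal n k).

Section B.
Variables n k : nat.
HB.instance Definition _ := GRing.Lmodule.copy (B n k) (lquot (@Bideal n k)).

Definition Bpi : B0 n k -> B n k := lpi (@Bideal n k).

Definition B_mul (a b : B n k) : B n k := Bpi (lrepr a * lrepr b).

Lemma Bpi_mul (a b : B0 n k) : Bpi (a * b) = B_mul (Bpi a) (Bpi b).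
Proof.
have mem c : (c \in @Bideal n k) <-> ideal (@Brel n k) c by split=> /asboolP.
have reprP c : c - lrepr (Bpi c) \in @Bideal n k by rewrite -lpi_eq lreprK.
apply/eqP; rewrite lpi_eq.
rewrite (_ : _ - _ = a * (b - lrepr (Bpi b)) + (a - lrepr (Bpi a)) * lrepr (Bpi b)).
  by apply: rpredD; apply/mem; [apply/ideal_mull/mem | apply/ideal_mulr/mem].
by rewrite mulrBr mulrBl addrA subrK.
Qed.

Lemma BpiK : cancel (@lrepr _ _ _ : B n k -> B0 n k) Bpi.
Proof. exact: lreprK. Qed.

Lemma BpiD : {morph Bpi : a b / a + b}.
Proof. exact: raddfD. Qed.

Fact B_mulA : associative B_mul.
Proof.
move=> a b c; rewrite -[a]BpiK -[b]BpiK -[c]BpiK.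
by move: (lrepr a) (lrepr b) (lrepr c) => u v w; rewrite -!Bpi_mul mulrA.
Qed.
Fact B_mul1l : left_id (Bpi 1) B_mul.
Proof. by move=> a; rewrite -[a]BpiK -Bpi_mul mul1r. Qed.
Fact B_mul1r : right_id (Bpi 1) B_mul.
Proof. by move=> a; rewrite -[a]BpiK -Bpi_mul mulr1. Qed.
Fact B_mulDl : left_distributive B_mul +%R.
Proof.
move=> a b c; rewrite -[a]BpiK -[b]BpiK -[c]BpiK.
move: (lrepr a) (lrepr b) (lrepr c) => u v w.
by rewrite -BpiD -!Bpi_mul mulrDl BpiD.
Qed.
Fact B_mulDr : right_distributive B_mul +%R.
Proof.
move=> a b c; rewrite -[a]BpiK -[b]BpiK -[c]BpiK.
move: (lrepr a) (lrepr b) (lrepr c) => u v w.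
by rewrite -BpiD -!Bpi_mul mulrDr BpiD.
Qed.

HB.instance Definition _ := GRing.Zmodule_isPzRing.Build (B n k)
  B_mulA B_mul1l B_mul1r B_mulDl B_mulDr.

Lemma BpiM : {morph Bpi : a b / a * b}.
Proof. exact: Bpi_mul. Qed.

Lemma Bpi1 : Bpi 1 = 1.
Proof. by []. Qed.

Lemma Bpi_eq0 a : (Bpi a == 0) = (a \in @Bideal n k).
Proof. exact: lpi_eq0. Qed.

Definition Uvar (i : 'I_n) : B n k := Bpi (Uel k i).

Lemma Uvar_central i a : a * Uvar i = Uvar i * a.
Proof. by rewrite -[a]BpiK -!BpiM Uel_central. Qed.

End B.

Notation genS S x y :=
  {g | generating x y g && (lines g :&: S != set0)}.

Section BS.
Variables (n k : nat) (S : {set 'I_n}).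

Definition BS : Type := sqz (B n k) {i : 'I_n | i \in S}.
HB.instance Definition _ :=
  GRing.Lmodule.copy BS (sqz (B n k) {i : 'I_n | i \in S}).
HB.instance Definition _ :=
  GRing.PzRing.copy BS (sqz (B n k) {i : 'I_n | i \in S}).

Definition dBS : BS -> BS := sqz_diff (fun j => Uvar k (val j)).

Fact dBSB : zmod_morphism dBS.
Proof. exact: sqz_diffB. Qed.
HB.instance Definition _ := GRing.isZmodMorphism.Build BS BS dBS dBSB.
HB.instance Definition _ :=
  GRing.isScalable.Build 'F_2 BS BS *:%R dBS (F2_scalable dBSB).

Lemma dBS_cst (b : B n k) : dBS (sqz_cst _ b) = 0.
Proof. exact: sqz_diff_cst. Qed.

Lemma dBS_var j : dBS (sqz_var _ j) = sqz_cst _ (Uvar k (val j)).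
Proof. exact: sqz_diff_var. Qed.

Lemma dBSM (a b : BS) : dBS (a * b) = dBS a * b + a * dBS b.
Proof.
by apply: sqz_diffM => [j|]; [apply: Uvar_central | apply: F2_addrr].
Qed.

Lemma dBSK (a : BS) : dBS (dBS a) = 0.
Proof.
by apply: sqz_diffK => [j|]; [apply: Uvar_central | apply: F2_addrr].
Qed.

Definition Iel (x : vert n k) : BS := sqz_cst _ (Bpi (fel 1 x x)).

Definition block (x y : vert n k) : {pred BS} :=
  fun a => `[< exists b : BS, a = Iel x * b * Iel y >].

Fact block_closed x y : submod_closed (block x y).
Proof.
apply: F2_submod_closed => [|a b]; rewrite ?unfold_in.
  by apply/asboolP; exists 0; rewrite mulr0 mul0r.
move=> /asboolP[a' ->] /asboolP[b' ->]; apply/asboolP.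
by exists (a' + b'); rewrite mulrDr mulrDl.
Qed.
HB.instance Definition _ x y :=
  GRing.isSubmodClosed.Build 'F_2 BS (block x y) (block_closed x y).

(* Polynomials in the U_i and the C_i, subject to C_i ^ 2 = 0. *)
Definition UCpoly : Type := sqz {mpoly 'F_2[n]} {i : 'I_n | i \in S}.
HB.instance Definition _ :=
  GRing.ComPzRing.copy UCpoly (sqz {mpoly 'F_2[n]} {i : 'I_n | i \in S}).

Definition Upoly (p : {mpoly 'F_2[n]}) : UCpoly := sqz_cst _ p.
Definition Cvar (j : {i : 'I_n | i \in S}) : UCpoly := sqz_var _ j.

(* phi (c p) = c p f_{x,y}, extended additively. *)
Definition phi (x y : vert n k) (q : UCpoly) : BS :=
  [ffun T => Bpi (fel (q T) x y)].

(* Since epsilon_a = 0 when the a-th generating interval misses S, epsilon is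
   given on the generating intervals meeting S, and so is the choice of i_a. *)
Definition basis_elt (x y : vert n k) (ic : genS S x y -> {i : 'I_n | i \in S})
    (eps : {ffun genS S x y -> bool}) (m : 'X_{1..n}) : BS :=
  phi x y (Upoly 'X_[m] * \prod_(g : genS S x y)
    (Cvar (ic g) * Upoly 'X_[pmon (val g) - U_(val (ic g))]) ^+ eps g).

Definition admissible (x y : vert n k) (m : 'X_{1..n}) : bool :=
  [forall i in S, m i == 0%N] &&
  [forall g, generating x y g ==> ~~ (pmon g <= m)%MM].

End BS.

Arguments block {n k} S x y.
Arguments admissible {n k} S x y m.

(* Main.v *)
(* A monomial U^m f_{x,y} crosses the line i a total of 2 m_i + |v_i(x,y)| times,
   a quantity that is additive under products. It vanishes in B(n,k) as soon as
   two holes of x are joined by lines that are all crossed. This condition is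
   stable under multiplication and satisfied by the defining relations; when x and
   y are not far it amounts to divisibility by some p_a. Hence I_x B I_y is the
   quotient of the polynomial ring by the monomial ideal generated by the p_a.

   The complex is then graded by the total exponent M of a monomial
   U^m \prod_(j in T) C_j, in which C_j counts as U_j. In degree M it is spanned by
   the subsets T of S that lie in the support of M and contain, in each generating
   interval a with p_a | M, a line j with M_j = 1. It is a cone, hence acyclic, when
   some line of S in the support of M does not occur in this condition; otherwise it
   is a tensor product of complexes of nonempty subsets of the sets S \cap a, whose
   homology is one-dimensional, generated by any choice of one point in each. *)
Require Import Defs.
From HB Require Import structures.
From mathcomp Require Import all_boot all_order all_algebra.
From mathcomp Require Import mpoly.
From mathcomp Require Import zify.
From mathcomp Require Import boolp.

Set Implicit Arguments.
Unset Strict Implicit.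
Unset Printing Implicit Defensive.

Import GRing.Theory Num.Theory.
Local Open Scope ring_scope.

(** * Crossings *)

Section Flux.
Variables n k : nat.
Implicit Types (x y z w : vert n k) (X : {set 'I_n.+1}) (m : 'X_{1..n}).

Definition cnt X (i : nat) : nat := #|[set t in X | (i <= t)%N]|.

Lemma cntS X (i : 'I_n.+1) : cnt X i = ((i \in X) + cnt X i.+1)%N.
Proof.
rewrite /cnt (cardsD1 i) !inE leqnn andbT; congr (_ + _)%N.
apply: eq_card => t; rewrite !inE -val_eqE /=; case: (t \in X); rewrite ?andbF //=.
by rewrite ltn_neqAle eq_sym.
Qed.

Lemma cnt_ge X i : (n < i)%N -> cnt X i = 0%N.
Proof.
move=> ni; apply: eq_card0 => t; rewrite !inE.
by have := ltn_ord t; case: (t \in X) => //=; lia.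
Qed.

Lemma cnt0 X : cnt X 0 = #|X|.
Proof. by apply: eq_card => t; rewrite !inE andbT. Qed.

Lemma vdiffE x y i : vdiff x y i = (cnt (val y) i)%:Z - (cnt (val x) i)%:Z.
Proof. by []. Qed.

Lemma vdiff0 x y : vdiff x y 0 = 0.
Proof. by rewrite vdiffE !cnt0 (eqP (valP x)) (eqP (valP y)) subrr. Qed.

Lemma vdiff_ge x y i : (n < i)%N -> vdiff x y i = 0.
Proof. by move=> ni; rewrite vdiffE !cnt_ge. Qed.

Lemma vdiffS x y (i : 'I_n.+1) :
  vdiff x y i = vdiff x y i.+1 + (i \in val y)%:Z - (i \in val x)%:Z.
Proof.
rewrite !vdiffE (cntS (val x)) (cntS (val y)).
by move: (cnt _ _) (cnt _ _) (_ \in _) (_ \in _); lia.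
Qed.

Lemma vdiffC x y i : vdiff y x i = - vdiff x y i.
Proof. by rewrite !vdiffE opprB. Qed.

Lemma cnt_interval X (s t : nat) : (s <= t.+1)%N ->
  cnt X s = (#|[set u in X | (s <= u <= t)%N]| + cnt X t.+1)%N.
Proof.
move=> st; rewrite /cnt -cardsUI [X in (_ + X)%N]eq_card0 ?addn0; last first.
  by move=> u; rewrite !inE; case: (u \in X) => //=; lia.
by apply: eq_card => u; rewrite !inE; case: (u \in X) => //=; lia.
Qed.

(* Two holes of x joined by lines of Q. For Q the set of lines i such that
   m_i <> 0 or v_i(x,y) <> 0, this says that U^m f_{x,y} vanishes in B(n,k). *)
Definition joined_holes X (Q : pred 'I_n) : Prop :=
  exists s t : 'I_n.+1, [/\ (s < t)%N, s \notin X, t \notin X &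
    forall i : 'I_n, (s <= i < t)%N -> Q i].

Lemma joined_holesW X (Q Q' : pred 'I_n) :
  subpred Q Q' -> joined_holes X Q -> joined_holes X Q'.
Proof. by move=> QQ' [s [t [st sX tX HQ]]]; exists s, t; split=> // i /HQ/QQ'. Qed.

(* Outside Q nothing crosses a line, so x and y have equally many elements,
   hence equally many holes, in each maximal segment connected through Q. *)
Lemma joined_holes_sym x y (Q : pred 'I_n) :
  (forall i : 'I_n, ~~ Q i -> vdiff x y i.+1 = 0) ->
  joined_holes (val x) Q -> joined_holes (val y) Q.
Proof.
move=> HQ [s [t [st sx tx Qst]]].
(* [s'] and [t'] bound the maximal segment around [s] connected through [Q]. A line just outside it
   is not in [Q], so v vanishes there; at the ends of [0, n] it vanishes because [x] and [y] both
   have [k] elements. *)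
pose Pl s' := [forall i : 'I_n, (s' <= i < s)%N ==> Q i].
have exl : exists s', Pl s' by exists s; apply/forallP=> i; apply/implyP; lia.
pose Pr t' := (t' <= n)%N && [forall i : 'I_n, (s <= i < t')%N ==> Q i].
have Prt : Pr t.
  by apply/andP; split; [rewrite -ltnS | apply/forallP=> i; apply/implyP/Qst].
have exr : exists t', Pr t' by exists t.
have Prn t' : Pr t' -> (t' <= n)%N by case/andP.
case: (ex_minnP exl) => s' /forallP Ps' mins.
case: (ex_maxnP exr Prn) => t' /andP[t'n /forallP Pt'] maxt.
have s's : (s' <= s)%N by apply: mins; apply/forallP=> i; apply/implyP; lia.
have tt' : (t <= t')%N by apply: maxt.
have Qin (i : 'I_n) : (s' <= i < t')%N -> Q i.
  move=> ii; case: (leqP s i) => is_.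
    by apply: (implyP (Pt' i)); lia.
  by apply: (implyP (Ps' i)); lia.
have vs : vdiff x y s' = 0.
  case: s' {Qin} s's Ps' mins => [|s'] s's Ps' mins; first exact: vdiff0.
  have s'n : (s' < n)%N by have := ltn_ord s; lia.
  apply: (HQ (Ordinal s'n)); apply/negP => Qs'.
  suff /mins : Pl s' by lia.
  apply/forallP=> i; apply/implyP => ii.
  have [e|ne] := eqVneq (i : nat) s'.
    by rewrite (_ : i = Ordinal s'n) //; apply: val_inj.
  by apply: (implyP (Ps' i)); lia.
have vt : vdiff x y t'.+1 = 0.
  have [t'n'|] := ltnP t' n; last by move=> ?; apply: vdiff_ge; lia.
  apply: (HQ (Ordinal t'n')); apply/negP => Qt'.
  suff /maxt : Pr t'.+1 by lia.
  apply/andP; split; first lia.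
  apply/forallP=> i; apply/implyP => ii.
  have [e|ne] := eqVneq (i : nat) t'.
    by rewrite (_ : i = Ordinal t'n') //; apply: val_inj.
  by apply: (implyP (Pt' i)); lia.
pose seg := [set u : 'I_n.+1 | (s' <= u <= t')%N].
have holes X : (#|[set u in X | (s' <= u <= t')%N]| + #|seg :\: X| = #|seg|)%N.
  by rewrite -(cardsID X seg); congr (_ + _)%N; apply: eq_card => u; rewrite !inE andbC.
have le : (s' <= t'.+1)%N by lia.
move: vs vt; rewrite !vdiffE.
have := cnt_interval (val x) le; have := cnt_interval (val y) le.
have := holes (val x); have := holes (val y).
have : (1 < #|seg :\: val x|)%N.
  apply/card_gt1P; exists s, t; rewrite !inE sx tx -val_eqE /=; split=> //; lia.
move=> hx h1 h2 h3 h4 h5 h6.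
have : (1 < #|seg :\: val y|)%N by lia.
case/card_gt1P => a [b [+ + ab]]; rewrite !inE => /andP[ay asg] /andP[bY bsg].
case: (ltngtP a b) => [lt|lt|/val_inj e]; last by rewrite e eqxx in ab.
  by exists a, b; split=> // i ii; apply: Qin; clear -ii asg bsg; lia.
by exists b, a; split=> // i ii; apply: Qin; clear -ii asg bsg; lia.
Qed.

Definition conn x y m : pred 'I_n := fun i => (m i != 0%N) || (vdiff x y i.+1 != 0).

Definition dead x y m : Prop := joined_holes (val x) (conn x y m).

(** Crossings add up, 2 mulexp + |v(x,y)| = |v(x,w)| + |v(w,y)|, so the product crosses every line
    that the left factor crosses, and both start at [x]. *)
Lemma dead_mulr x w y m m' :
  dead x w m -> (forall i : 'I_n, (mulexp x w y i.+1 + m i <= m' i)%N) ->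
  dead x y m'.
Proof.
move=> dm le; apply: joined_holesW dm => i; rewrite /conn; move: (le i).
by rewrite /mulexp /vdiff; lia.
Qed.

(** The right factor starts at [w], not at [x]: its joined holes are carried to the common end [y],
    and from there back to [x] along the lines crossed by the product. *)
Lemma dead_mull x w y m m' :
  dead w y m -> (forall i : 'I_n, (mulexp x w y i.+1 + m i <= m' i)%N) ->
  dead x y m'.
Proof.
move=> dm le.
apply: (@joined_holes_sym y x) => [i|].
  by rewrite (vdiffC x y) /conn negb_or !negbK => /andP[_ /eqP->]; rewrite oppr0.
have : joined_holes (val y) (conn w y m).
  apply: joined_holes_sym dm => i.
  by rewrite /conn negb_or !negbK => /andP[_ /eqP->].
apply: joined_holesW => i; rewrite /conn; move: (le i).
by rewrite /mulexp /vdiff; lia.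
Qed.

End Flux.

(** * Dead monomials and the defining ideal *)

Section Ideal.
Variables n k : nat.
Implicit Types (x y z w : vert n k) (m : 'X_{1..n}) (a b : B0 n k).

Lemma mulmonE x y z : mulmon x y z = 'X_[[multinom mulexp x y z i.+1 | i < n]].
Proof. by rewrite mpolyXE_id; apply: eq_bigr => i _; rewrite mnmE. Qed.

Lemma B0_mulE (c d : B0 n k) x z :
  (c * d) (x, z) = \sum_y mulmon x y z * c (x, y) * d (y, z).
Proof. exact: ffunE. Qed.

Lemma felE (p : {mpoly 'F_2[n]}) x y u v : fel p x y (u, v) = if (u == x) && (v == y) then p else 0.
Proof. by rewrite ffunE xpair_eqE. Qed.

Lemma msupp_B0_mul a b x z m : m \in msupp ((a * b) (x, z)) ->
  exists y m1 m2, [/\ m1 \in msupp (a (x, y)), m2 \in msupp (b (y, z)) &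
    forall i : 'I_n, m i = (mulexp x y z i.+1 + m1 i + m2 i)%N].
Proof.
rewrite ffunE => /msupp_sum_le/flattenP[s /mapP[y _ ->]] /=.
rewrite mulmonE => /msuppM_le/allpairsP[[u m2] /= [+ m2b ->]].
move=> /msuppM_le/allpairsP[[e m1] /= [+ m1a ->]].
rewrite msuppX inE => /eqP->; exists y, m1, m2; split=> // i.
by rewrite !mnmE.
Qed.

Definition dead_elt a : Prop := forall x y m, m \in msupp (a (x, y)) -> dead x y m.

Lemma dead_elt_mulr a b : dead_elt a -> dead_elt (a * b).
Proof.
move=> da x z m /msupp_B0_mul[y [m1 [m2 [m1a _ mE]]]].
by apply: dead_mulr (da _ _ _ m1a) _ => i; rewrite mE leq_addr.
Qed.

Lemma dead_elt_mull a b : dead_elt b -> dead_elt (a * b).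
Proof.
move=> db x z m /msupp_B0_mul[y [m1 [m2 [_ m2b mE]]]].
by apply: dead_mull (db _ _ _ m2b) _ => i; rewrite mE addnAC leq_addr.
Qed.

Lemma fel_sumE (P : vert n k -> pred (vert n k)) (p : {mpoly 'F_2[n]}) x y :
  (\sum_(x' : vert n k) \sum_(y' : vert n k | P x' y') fel p x' y' : B0 n k) (x, y)
  = if P x y then p else 0.
Proof.
rewrite sum_ffunE (bigD1 x) //= [X in _ + X]big1 => [|x' /negbTE x'x]; last first.
  by rewrite sum_ffunE big1 // => y' _; rewrite felE eq_sym x'x.
rewrite sum_ffunE addr0; case Pxy: (P x y).
  transitivity ((fel p x y : B0 n k) (x, y)); last by rewrite felE !eqxx.
  rewrite (bigD1 y Pxy) /= [X in _ + X]big1 => [|y' /andP[_ /negbTE y'y]].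
    exact: addr0.
  by rewrite felE eqxx eq_sym y'y.
apply: big1 => y' Pxy'; rewrite felE eqxx /=.
by case: (y =P y') => // yy'; rewrite yy' Pxy' in Pxy.
Qed.

Lemma msupp_if (b : bool) (p : {mpoly 'F_2[n]}) m :
  m \in msupp (if b then p else 0) -> b.
Proof. by case: b => //; rewrite msupp0. Qed.

Lemma msupp_Rel (i : 'I_n) x y m : m \in msupp (Rel k i (x, y)) ->
  [/\ lft i \in val x, rgt i \notin val x & val y = rgt i |: (val x :\ lft i)].
Proof.
rewrite (fel_sumE (fun x y => [&& lft i \in val x, rgt i \notin val x
   & val y == rgt i |: (val x :\ lft i)])).
by move=> /msupp_if/and3P[? ? /eqP].
Qed.

Lemma msupp_Lel (i : 'I_n) x y m : m \in msupp (Lel k i (x, y)) ->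
  [/\ rgt i \in val x, lft i \notin val x & val y = lft i |: (val x :\ rgt i)].
Proof.
rewrite (fel_sumE (fun x y => [&& rgt i \in val x, lft i \notin val x
   & val y == lft i |: (val x :\ rgt i)])).
by move=> /msupp_if/and3P[? ? /eqP].
Qed.

Lemma cnt_swap (X : {set 'I_n.+1}) (s t : 'I_n.+1) i : s \in X -> t \notin X ->
  (cnt (t |: (X :\ s)) i + (i <= s) = cnt X i + (i <= t))%N.
Proof.
move=> sX tX.
have cntE Y : cnt Y i = (\sum_(u in Y) (i <= u))%N.
  rewrite /cnt -sum1_card big_mkcond [RHS]big_mkcond; apply: eq_bigr => u _.
  by rewrite inE; case: (u \in Y); case: (i <= u)%N.
rewrite !cntE big_setU1 /=; last by rewrite !inE (negbTE tX) andbF.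
rewrite [in RHS](big_setD1 s) //=.
by rewrite [LHS]addnAC [RHS]addnAC [in RHS](addnC (i <= s)%N).
Qed.

Lemma Brel_dead a : Brel a -> dead_elt a.
Proof.
case=> {a} [i j ij|i j ij|x i li ri] x' y' m /msupp_B0_mul[w [m1 [m2 [m1a m2a mE]]]].
- have [lx rx wE] := msupp_Rel m1a; have [lw rw yE] := msupp_Rel m2a.
  have e : lft j = rgt i by apply: val_inj; rewrite /= ij.
  have rj : rgt j \notin val x'.
    apply: contraNN rw; rewrite wE !inE -!val_eqE /= /bump /= => ->.
    by rewrite andbT; apply/orP; right; lia.
  (* An element travels from [lft i] over [rgt i] to [rgt j]. The last two are holes of [x'], and
     the line [j] between them is crossed. *)
  exists (rgt i), (rgt j); split=> // [|l]; first by rewrite /= /bump /= ij; lia.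
  rewrite /= /bump /= => il; rewrite /conn.
  have -> : l = j by apply: val_inj => /=; lia.
  apply/orP; right; rewrite vdiffE.
  have := cnt_swap j.+1 lw rw; have := cnt_swap j.+1 lx rx.
  by rewrite -wE -yE /= /bump /= ij; lia.
- have [lx rx wE] := msupp_Lel m1a; have [lw rw yE] := msupp_Lel m2a.
  have e : lft j = rgt i by apply: val_inj; rewrite /= ij.
  have rj : lft i \notin val x'.
    apply: contraNN rw; rewrite wE !inE -!val_eqE /= /bump /= => ->.
    by rewrite andbT; apply/orP; right; lia.
  (* The mirror image: the element travels from [rgt j] down to [lft i] and crosses the line [i]
     between two holes. *)
  exists (lft i), (rgt i); split=> // [|l]; first by rewrite -e.
  rewrite /= /bump /= => il; rewrite /conn.
  have -> : l = i by apply: val_inj => /=; lia.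
  apply/orP; right; rewrite vdiffE.
  have := cnt_swap i.+1 lw rw; have := cnt_swap i.+1 lx rx.
  by rewrite -wE -yE /= /bump /= ij; lia.
move: m1a m2a; rewrite UelE ffunE xpair_eqE.
case: (x' =P x) => [->|_]; last by rewrite msupp0.
case: (w =P y') => [_ _|_]; last by rewrite msupp0.
rewrite msuppX inE => /eqP m2E.
(* Here [x'] itself has holes on both sides of the line, which the factor U_i crosses. *)
exists (lft i), (rgt i); split=> // l.
rewrite /= /bump /= => il; rewrite /conn.
have -> : l = i by apply: val_inj => /=; lia.
by rewrite mE m2E mnm1E eqxx addnC.
Qed.

Lemma Bideal_dead a : a \in @Bideal n k -> dead_elt a.
Proof.
move=> /asboolP; elim=> {a} [a g b /Brel_dead dg|x y m|a b _ da _ db x y m].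
- exact/dead_elt_mulr/dead_elt_mull.
- by rewrite ffunE msupp0.
by rewrite ffunE => /msuppD_le; rewrite mem_cat => /orP[/da|/db].
Qed.

Lemma Bideal_mull a b : b \in @Bideal n k -> a * b \in @Bideal n k.
Proof. by move=> /asboolP Ib; apply/asboolP/ideal_mull. Qed.

End Ideal.

(** * Generating intervals *)

Section Generating.
Variables n k : nat.
Implicit Types (x y z w : vert n k) (m : 'X_{1..n}) (g h : 'I_n.+1 * 'I_n.+1).

Lemma cnt_coords x i : cnt (val x) i = (\sum_(a < k) (i <= nth 0 (coords x) a))%N.
Proof.
have -> : cnt (val x) i = count (leq i) (coords x).
  rewrite /cnt /coords count_map -sum1_card -sum1_count big_enum_cond /=.
  by apply: eq_bigl => t; rewrite !inE.
rewrite -sum1_count (big_nth 0%N) size_coords big_mkord big_mkcond.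
by apply: eq_bigr => a _; case: leqP.
Qed.

Lemma mem_coords x (a : 'I_k) :
  exists2 t, t \in val x & nth 0%N (coords x) a = t :> nat.
Proof.
have /mapP[t] : nth 0%N (coords x) a \in coords x by rewrite mem_nth ?size_coords.
by rewrite mem_enum; exists t.
Qed.

Lemma nfar_coords x y (a : 'I_k) : ~~ far x y ->
  (`|(nth 0%N (coords x) a)%:Z - (nth 0%N (coords y) a)%:Z| <= 1)%R.
Proof. by rewrite negb_exists => /forallP/(_ a); rewrite -Order.TotalTheory.leNgt. Qed.

(** Each coordinate of [x] lies strictly to one side of the hole [s] and moves by at most one, so it
    may reach [s] but not pass it. *)
Lemma nfar_hole x y (s : 'I_n.+1) : ~~ far x y -> s \notin val x ->
  (vdiff x y s.+1 <= 0 <= vdiff x y s)%R.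
Proof.
move=> nf sx.
have xs (a : 'I_k) : nth 0%N (coords x) a != s.
  have [t tx ->] := mem_coords x a.
  by apply: contraNneq sx => /val_inj <-.
rewrite !vdiffE !cnt_coords subr_ge0 subr_le0 !lez_nat.
by apply/andP; split; apply: leq_sum => a _; have := nfar_coords a nf; have := xs a; lia.
Qed.

(** By [vdiffS], v changes only at a coordinate lying in exactly one of [x] and [y]. *)
Lemma vdiff_fully_used x y (j u : 'I_n.+1) (i : nat) :
    (forall w : 'I_n.+1, (j < w < u)%N -> w \in fully_used x y) ->
  (j <= i < u)%N -> vdiff x y i.+1 = vdiff x y j.+1.
Proof.
move=> fu /andP[ji]; rewrite -(subnKC ji); elim: (i - j)%N => [|d IH] du.
  by rewrite addn0.
rewrite -IH; last by lia.
have wn : ((j + d).+1 < n.+1)%N by have := ltn_ord u; lia.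
have := fu (Ordinal wn); rewrite inE => /(_ ltac:(rewrite /=; lia))/andP[xw yw].
by have := vdiffS x y (Ordinal wn); rewrite xw yw addrK addnS.
Qed.

(* Between consecutive holes of x the function v is nondecreasing; it goes from
   a nonpositive to a nonnegative value when x and y are not far. *)
Lemma dead_generating x y m : ~~ far x y -> dead x y m ->
  exists2 g, generating x y g & (pmon g <= m)%MM.
Proof.
move=> nf [s [t0 [st0 sx t0x Qst0]]].
(* [t] is the first hole of [x] after [s]. *)
have ext : exists t : nat,
  [exists u : 'I_n.+1, (u == t :> nat) && (u \notin val x)] && (s < t)%N.
  by exists t0; rewrite st0 andbT; apply/existsP; exists t0; rewrite eqxx.
case: (ex_minnP ext) => t' /andP[/existsP[t /andP[/eqP <- tx]] st] mint {t' ext}.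
have tt0 : (t <= t0)%N.
  by apply: mint; rewrite st0 andbT; apply/existsP; exists t0; rewrite eqxx.
have inx (u : 'I_n.+1) : (s < u < t)%N -> u \in val x.
  move=> /andP[su ut]; apply: contraLR ut => ux; rewrite -leqNgt; apply: mint.
  by rewrite su andbT; apply/existsP; exists u; rewrite eqxx.
have {Qst0} Qst (i : 'I_n) : (s <= i < t)%N -> conn x y m i.
  by move=> ii; apply: Qst0; lia.
have /andP[vs _] := nfar_hole nf sx; have /andP[_ vt] := nfar_hole nf tx.
(* [j] is the first coordinate from [s] on with v_{j+1} >= 0. It lies before [t], since v_t >= 0 at
   the hole [t]. *)
have exj : exists j : nat, [&& (s <= j)%N, (j < t)%N & 0 <= vdiff x y j.+1].
  by exists t.-1; rewrite prednK; [rewrite vt; lia | lia].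
case: (ex_minnP exj) => j0 /and3P[sj0 j0t vj] minj {exj}.
have j0n : (j0 < n.+1)%N by have := ltn_ord t; lia.
pose j := Ordinal j0n; have jE : j = j0 :> nat by [].
(* If [j = s], the hole also gives v_{j+1} <= 0. Otherwise v_j < 0 and [j] is in [x], so v grows by
   at most one at [j]: it becomes exactly 0, which forces [j] out of [y]. *)
have [vj0 nfj] : vdiff x y j.+1 = 0 /\ j \notin fully_used x y.
  have [js|js] := eqVneq (j : nat) s.
    rewrite inE (val_inj js : j = s) (negbTE sx); split=> //.
    by move: vj vs; rewrite -jE js; lia.
  have := vdiffS x y j; have xj : j \in val x by apply: inx; lia.
  have : vdiff x y j < 0.
    rewrite Order.TotalTheory.ltNge; apply/negP => vj'.
    have := minj j0.-1; rewrite prednK; last lia.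
    by rewrite -jE vj' andbT; lia.
  by rewrite inE xj /=; move: vj; rewrite -jE; case: (j \in val y); lia.
(* [u] is the first coordinate after [j] that is not fully used; the hole [t] bounds it. *)
have exu : exists u : nat,
  [exists u' : 'I_n.+1, (u' == u :> nat) && (u' \notin fully_used x y)] && (j < u)%N.
  exists t; rewrite (_ : (j < t)%N = true) // andbT; apply/existsP; exists t.
  by rewrite eqxx inE (negbTE tx).
case: (ex_minnP exu) => u' /andP[/existsP[u /andP[/eqP <- nfu]] ju] minu {u' exu}.
have ut : (u <= t)%N.
  apply: minu; rewrite (_ : (j < t)%N = true) // andbT; apply/existsP; exists t.
  by rewrite eqxx inE (negbTE tx).
have fu (w : 'I_n.+1) : (j < w < u)%N -> w \in fully_used x y.
  move=> /andP[jw wu]; apply: contraLR wu => fw; rewrite -leqNgt; apply: minu.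
  by rewrite jw andbT; apply/existsP; exists w; rewrite eqxx.
have vl (i : 'I_n) : i \in lines (j, u) -> vdiff x y i.+1 = 0.
  by rewrite inE /= => /(vdiff_fully_used fu)->.
exists (j, u); first apply/and5P; first split=> //=.
- by apply/forallP=> w; apply/implyP/fu.
- by apply/forallP=> i; apply/implyP=> /vl->.
apply/mnm_lepP=> i; rewrite mnmE; case: (boolP (i \in _)) => // il.
have := Qst i; rewrite /conn vl // eqxx orbF lt0n; apply.
by move: il; rewrite inE /=; lia.
Qed.

(** The ends of a generating interval are not fully used and its inner coordinates are, so no end of
    one interval lies strictly inside another. *)
Lemma generating_disjoint x y g h i : generating x y g -> generating x y h ->
  i \in lines g -> i \in lines h -> g = h.
Proof.
case: g => j u; case: h => j' u' /and5P[/= ju jf uf /forallP gf _].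
move=> /and5P[/= ju' jf' uf' /forallP hf _]; rewrite !inE /= => ii ii'.
have gf' (w : 'I_n.+1) : w \notin fully_used x y -> ~~ (j < w < u)%N.
  by move=> nw; apply: contraNN nw => lw; apply: implyP (gf w) lw.
have hf' (w : 'I_n.+1) : w \notin fully_used x y -> ~~ (j' < w < u')%N.
  by move=> nw; apply: contraNN nw => lw; apply: implyP (hf w) lw.
have := gf' _ jf'; have := gf' _ uf'; have := hf' _ jf; have := hf' _ uf.
by move=> *; congr pair; apply: val_inj => /=; lia.
Qed.

Lemma felD (p q : {mpoly 'F_2[n]}) x y : fel (p + q) x y = fel p x y + fel q x y.
Proof. by apply/ffunP=> xy; rewrite !ffunE; case: eqP; rewrite ?addr0. Qed.

Lemma fel0 x y : fel 0 x y = 0.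
Proof. by apply/ffunP=> xy; rewrite !ffunE; case: eqP. Qed.

Lemma fel_Uel p x y i : fel p x y * Uel k i = fel (p * 'X_i) x y.
Proof.
apply/ffunP=> -[a b]; rewrite [LHS]ffunE /= (bigD1 b) //= UelE eqxx mulmon1r mul1r.
rewrite big1 ?addr0 => [|w /negbTE wb]; last by rewrite UelE wb mulr0.
by rewrite !ffunE; case: eqP => // _; rewrite mul0r.
Qed.

Lemma mulexp_eql x z y i : cnt (val z) i = cnt (val x) i -> mulexp x z y i = 0%N.
Proof. by rewrite /mulexp !vdiffE => ->; move: (cnt _ _) (cnt _ _); lia. Qed.

Lemma mulexp_eqr x z y i : cnt (val z) i = cnt (val y) i -> mulexp x z y i = 0%N.
Proof. by rewrite /mulexp !vdiffE => ->; move: (cnt _ _) (cnt _ _); lia. Qed.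

(** The detour through [z] crosses the line once in each direction. *)
Lemma mulexp_pred x y z i : cnt (val y) i = cnt (val x) i ->
  cnt (val x) i = (cnt (val z) i).+1 -> mulexp x z y i = 1%N.
Proof. by rewrite /mulexp !vdiffE => -> ->; move: (cnt _ _); lia. Qed.

(* Move the fully used coordinates of the interval one step to the left, so as to
   leave the two ends of its last line free. *)
Lemma generating_Bideal x y g : generating x y g ->
  fel 'X_[pmon g] x y \in @Bideal n k.
Proof.
case: g => j u /and5P[/= ju jf uf /forallP fjut /forallP vl].
have fju (t : 'I_n.+1) : (j < t < u)%N -> (t \in val x) && (t \in val y).
  by move=> jt; have := implyP (fjut t) jt; rewrite inE.
have v0 i : (j < i <= u)%N -> cnt (val y) i = cnt (val x) i.
  move=> ji; have i'n : (i.-1 < n)%N by have := ltn_ord u; lia.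
  have := vl (Ordinal i'n); rewrite inE /= prednK; last lia.
  by rewrite vdiffE subr_eq0 => /implyP/(_ ltac:(lia))/eqP[].
(* [w1] and [w2] are whichever of [x] and [y] misses the end [j], respectively [u]. They may differ:
   [x] and [y] have equal counts at every line of the interval. *)
pose w1 := if j \in val x then y else x.
pose w2 := if u \in val x then y else x.
have jw1 : j \notin val w1.
  by rewrite /w1; move: jf; rewrite inE; case: (boolP (j \in val x)).
have uw2 : u \notin val w2.
  by rewrite /w2; move: uf; rewrite inE; case: (boolP (u \in val x)).
(* From [j] to [u - 1] this set is full except at [u - 1]. As [w2] misses [u], the last line lies
   between two holes. *)
pose z0 := [set t : 'I_n.+1 | if (t < j)%N then t \in val w1 else
                if (t < u)%N then (t.+1 < u)%N else t \in val w2].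
have cntz i : cnt z0 i = if (i <= j)%N then cnt (val w1) i else
    if (i < u)%N then (cnt (val x) i).-1 else cnt (val w2) i.
  have w1E d : (j < d <= u)%N -> cnt (val w1) d = cnt (val x) d.
    by rewrite /w1; case: ifP => // _ /v0.
  have w2E d : (j < d <= u)%N -> cnt (val w2) d = cnt (val x) d.
    by rewrite /w2; case: ifP => // _ /v0.
  (* Downward induction on [i], from beyond the last coordinate. *)
  move: {2}(n.+1 - i)%N (erefl (n.+1 - i)%N) => d; elim: d i => [|d IH] i di.
    have ni : (n < i)%N by lia.
    by rewrite !cnt_ge //= !if_same.
  have ni : (i < n.+1)%N by lia.
  rewrite (cntS _ (Ordinal ni)) /= IH; last lia.
  rewrite inE /=; have := ltn_ord u => un.
  case: (ltngtP i j) => [ij|ji|ij].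
  - by rewrite (cntS _ (Ordinal ni)).
  - case: (ltngtP i.+1 u) => iu; rewrite ?(ltnW iu) //; last first.
    + rewrite w2E; last lia.
      have /fju/andP[xi _] : (j < Ordinal ni < u)%N by rewrite /=; lia.
      by rewrite (cntS (val x) (Ordinal ni)) xi.
    + by rewrite (cntS (val w2) (Ordinal ni)).
    have /fju/andP[xi _] : (j < Ordinal ni < u)%N by rewrite /=; lia.
    rewrite (cntS (val x) (Ordinal ni)) xi /=.
    have i1n : (i.+1 < n.+1)%N by lia.
    have /fju/andP[xi1 _] : (j < Ordinal i1n < u)%N by rewrite /=; lia.
    by rewrite (cntS (val x) (Ordinal i1n)) xi1.
  have jE : j = Ordinal ni by apply: val_inj.
  have iu : (i < u)%N by rewrite ij.
  have -> : cnt (val w1) i = cnt (val x) i.+1.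
    rewrite -w1E; last lia.
    by rewrite (cntS (val w1) (Ordinal ni)) -jE (negbTE jw1) ij.
  rewrite iu; case: ltnP => iu'; last by rewrite w2E //; lia.
  have i1n : (i.+1 < n.+1)%N by lia.
  have /fju/andP[xi1 _] : (j < Ordinal i1n < u)%N by rewrite /=; lia.
  by rewrite (cntS (val x) (Ordinal i1n)) xi1.
have z0k : #|z0| == k by rewrite -cnt0 cntz leq0n cnt0 (eqP (valP w1)).
have [z valz] : exists z : vert n k, val z = z0 by exists (Sub z0 z0k).
have i0n : (u.-1 < n)%N by have := ltn_ord u; lia.
pose i0 := Ordinal i0n.
have lz : lft i0 \notin val z.
  rewrite valz inE (_ : (lft i0 < j)%N = false); last by rewrite /=; lia.
  rewrite (_ : (lft i0 < u)%N = true); last by rewrite /=; lia.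
  by rewrite /= prednK ?ltnn //; lia.
have rz : rgt i0 \notin val z.
  have -> : rgt i0 = u by apply: val_inj; rewrite /= /bump /=; lia.
  by rewrite valz inE ltnn (ltnNge u j) (ltnW ju) (negbTE uw2).
have := Brel_U lz rz; rewrite fel_Uel mul1r => Ui0.
(* The relation at the last line, multiplied into the path from [x] through [z] to [y], turns out to
   be the monomial of the interval. *)
have : fel 1 x z * fel 'X_i0 z z * fel 1 z y \in @Bideal n k.
  exact/asboolP/ideal_gen.
rewrite !fel_mul mulmon1r !mul1r mulr1 mulmonE -mpolyXD.
suff -> : ([multinom mulexp x z y i.+1 | i < n] + U_(i0))%MM = pmon (j, u) by [].
apply/mnmP=> i; rewrite !mnmE inE -val_eqE /=; have u0 : (0 < u)%N by lia.
(* Outside the interval, and at its last line, [z] has the count of [x] or of [y], so the detour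
   contributes no factor. *)
have zw1 : (i.+1 <= j)%N -> mulexp x z y i.+1 = 0%N.
  move=> ij; have := cntz i.+1; rewrite ij -valz /w1.
  by case: ifP => _ e; [exact: mulexp_eqr | exact: mulexp_eql].
have zw2 : (j < i.+1)%N -> (u <= i.+1)%N -> mulexp x z y i.+1 = 0%N.
  move=> ij iu; have := cntz i.+1; rewrite leqNgt ij ltnNge iu -valz /w2.
  by case: ifP => _ e; [exact: mulexp_eqr | exact: mulexp_eql].
case: (leqP i.+1 j) => ij.
  rewrite zw1 // (_ : (j <= i)%N = false); last by rewrite leqNgt ij.
  by apply/eqP; lia.
have -> : (j <= i)%N = true by [].
case: (ltnP i.+1 u) => iu; last first.
  by rewrite zw2 // ltn_neqAle; lia.
have -> : (i < u)%N = true by apply: ltnW.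
have -> : (u.-1 == i)%N = false by apply/eqP; lia.
(* At the other lines of the interval [z] counts one element less than [x] and [y], whence one
   factor U_i. *)
have /fju/andP[xi _] : (j < rgt i < u)%N by rewrite /= /bump /= add1n ij.
have xe : cnt (val x) i.+1 = (cnt (val x) i.+2).+1.
  by have := cntS (val x) (rgt i); rewrite xi.
have ze : cnt (val z) i.+1 = (cnt (val x) i.+1).-1.
  by rewrite valz cntz leqNgt ij iu.
have -> : mulexp x z y i.+1 = 1%N; last by [].
by apply: mulexp_pred; [rewrite v0 // ij ltnW | rewrite ze xe].
Qed.

(** The dead monomials bound the ideal from above and the monomials p_a from below; for states that
    are not far [dead_generating] makes the two bounds meet. *)
Lemma fel_Bideal x y (p : {mpoly 'F_2[n]}) : ~~ far x y ->
  (fel p x y \in @Bideal n k) <->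
  (forall m, p@_m != 0 -> exists2 g, generating x y g & (pmon g <= m)%MM).
Proof.
move=> nf; split=> [Ip m pm|Hp].
  apply: dead_generating => //; apply: (Bideal_dead Ip).
  by rewrite ffunE eqxx mcoeff_msupp.
rewrite [p]mpolyE (big_morph (fun p => fel p x y) (fun p q => felD p q x y) (fel0 x y)).
rewrite big_seq rpred_sum // => m; rewrite mcoeff_msupp => /Hp[g gg gm].
rewrite (_ : fel _ x y = fel (p@_m *: 'X_[m - pmon g]) x x * fel 'X_[pmon g] x y).
  by rewrite Bideal_mull // generating_Bideal.
by rewrite fel_mul mulmon1l mul1r -scalerAl -mpolyXD submK.
Qed.

End Generating.

(** * The blocks I_x B I_y *)

Section SqzExtra.
Variables (A : pzRingType) (J : finType).

Lemma sqz_cst_mull (u : A) (b : sqz A J) T : (sqz_cst J u * b) T = u * b T.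
Proof.
rewrite sqz_mulE (bigD1 set0) ?sub0set //= setD0 ffunE eqxx big1 ?addr0 // => P.
by case/andP=> _ /negbTE P0; rewrite ffunE P0 mul0r.
Qed.

Lemma sqz_cst_mulr (u : A) (b : sqz A J) T : (b * sqz_cst J u) T = b T * u.
Proof.
rewrite sqz_mulE (bigD1 T) //= setDv ffunE eqxx big1 ?addr0 // => P /andP[PT nPT].
rewrite ffunE ifF ?mulr0 //; apply: contraNF nPT => /eqP/eqP.
by rewrite setD_eq0 eqEsubset PT.
Qed.

Lemma sqz_monM (u v : A) (P Q : {set J}) : [disjoint P & Q] ->
  sqz_mon u P * sqz_mon v Q = sqz_mon (u * v) (P :|: Q).
Proof.
move=> PQ; apply/ffunP=> T; rewrite sqz_mulE ffunE.
have DP : (P :|: Q) :\: P = Q.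
  by rewrite setDUl setDv set0U; apply/setDidPl; rewrite disjoint_sym.
case: eqP => [->|TPQ].
  rewrite (bigD1 P) ?subsetUl //= DP !ffunE !eqxx big1 ?addr0 //.
  by move=> R /andP[_ /negbTE RP]; rewrite ffunE RP mul0r.
apply: big1 => R RT; rewrite !ffunE; case: eqP => [RP|]; last by rewrite mul0r.
case: eqP => [TRQ|]; last by rewrite mulr0.
by case: TPQ; rewrite -RP -TRQ setDE setUIr setUCr setIT; apply/esym/setUidPr.
Qed.

End SqzExtra.

Section Blocks.
Variables (n k : nat) (S : {set 'I_n}).
Implicit Types (x y : vert n k) (a b : BS k S).

Local Notation J := {i : 'I_n | i \in S}.

Lemma fel_cornerl (c : B0 n k) x u v :
  (fel 1 x x * c) (u, v) = if u == x then c (x, v) else 0.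
Proof.
rewrite B0_mulE (bigD1 x) //= felE eqxx andbT big1 ?addr0 => [|w /negbTE wx].
  by case: eqP => [->|_]; rewrite ?mulmon1l ?mul1r // mulr0 mul0r.
by rewrite felE wx andbF mulr0 mul0r.
Qed.

Lemma fel_cornerr (c : B0 n k) y u v :
  (c * fel 1 y y) (u, v) = if v == y then c (u, y) else 0.
Proof.
rewrite B0_mulE (bigD1 y) //= felE eqxx /= big1 ?addr0 => [|w /negbTE wy].
  by case: eqP => [->|_]; rewrite ?mulmon1r ?mul1r ?mulr1 // mulr0.
by rewrite felE wy mulr0.
Qed.

Lemma fel_corner (c : B0 n k) x y : fel 1 x x * c * fel 1 y y = fel (c (x, y)) x y.
Proof.
apply/ffunP=> -[u v]; rewrite fel_cornerr felE fel_cornerl.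
by case: (u == x); case: (v == y).
Qed.

Lemma Bpi0 : Bpi 0 = 0 :> B n k.
Proof. exact: (raddf0 (lpi (@Bideal n k))). Qed.

Lemma Bpi_sum (I : Type) (r : seq I) (P : pred I) (F : I -> B0 n k) :
  Bpi (\sum_(i <- r | P i) F i) = \sum_(i <- r | P i) Bpi (F i).
Proof. exact: (raddf_sum (lpi (@Bideal n k))). Qed.

Lemma IelM x y : Iel S x * Iel S y = if x == y then Iel S x else 0.
Proof.
rewrite /Iel -sqz_cstM -BpiM; case: eqP => [->|/eqP xy].
  by rewrite fel_mul mulmon1l !mul1r.
rewrite fel_mul0 // Bpi0.
by apply/ffunP=> T; rewrite !ffunE; case: eqP.
Qed.

Lemma Iel_sum : \sum_(x : vert n k) Iel S x = 1.
Proof.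
apply/ffunP=> T; rewrite sum_ffunE ffunE; case: eqP => [->|/eqP/negbTE T0].
  under eq_bigr => x _ do rewrite ffunE eqxx.
  by rewrite -Bpi_sum Bpi1.
by rewrite big1 // => x _; rewrite ffunE T0.
Qed.

Lemma corner_corner x y a :
  Iel S x * (Iel S x * a * Iel S y) * Iel S y = Iel S x * a * Iel S y.
Proof.
have ee (z : vert n k) : Iel S z * Iel S z = Iel S z by rewrite IelM eqxx.
move: (Iel S x) (Iel S y) (ee x) (ee y) => e f {}ee ff.
by rewrite !mulrA ee -!mulrA ff.
Qed.

Lemma corner_neq x y x' y' a : (x', y') != (x, y) ->
  Iel S x * (Iel S x' * a * Iel S y') * Iel S y = 0.
Proof.
rewrite xpair_eqE negb_and => ne.
have : Iel S x * Iel S x' = 0 \/ Iel S y' * Iel S y = 0.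
  by case/orP: ne => /negbTE ne; [left; rewrite IelM eq_sym ne | right; rewrite IelM ne].
move: (Iel S x) (Iel S x') (Iel S y) (Iel S y') => e e' f f'.
by rewrite !mulrA -(mulrA _ f') => -[->|->]; rewrite ?mul0r ?mulr0 ?mul0r.
Qed.

Lemma blockP x y a : reflect (a = Iel S x * a * Iel S y) (a \in block S x y).
Proof.
apply: (iffP (asboolP (exists b : BS k S, a = Iel S x * b * Iel S y)));
  last by move=> aE; exists a.
move=> [b ->].
by rewrite corner_corner.
Qed.

Lemma dBS_corner x y a : dBS (Iel S x * a * Iel S y) = Iel S x * dBS a * Iel S y.
Proof.
have dI (z : vert n k) : dBS (Iel S z) = 0 by exact: dBS_cst.
move: (Iel S x) (Iel S y) (dI x) (dI y) => e f de df.
by rewrite dBSM df mulr0 addr0 dBSM de mul0r add0r.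
Qed.

(** The [Iel S x] are orthogonal idempotents of sum 1 killed by the differential, so this is a
    Peirce decomposition compatible with [dBS]. *)
Lemma direct_sum_blocks :
  direct_sum_complex (@dBS n k S)
    (fun xy : vert n k * vert n k => block S xy.1 xy.2).
Proof.
split=> [[x y] a /blockP aE|a].
  by apply/blockP; rewrite {1}aE; exact: dBS_corner.
exists [ffun xy : vert n k * vert n k => Iel S xy.1 * a * Iel S xy.2]; split.
  split=> [[x y]|]; first by rewrite ffunE; apply/asboolP; exists a.
  rewrite -[LHS]mul1r -[LHS]mulr1 -{1 2}Iel_sum.
  rewrite mulr_suml mulr_sumr; under eq_bigr do rewrite mulr_suml.
  rewrite exchange_big pair_bigA.
  by apply: eq_bigr => -[x y] _; rewrite ffunE.
move=> f [fC ->]; apply/ffunP=> -[x y]; rewrite ffunE /= mulr_sumr mulr_suml.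
rewrite (bigD1 (x, y)) //= -(elimT (blockP _ _ _) (fC (x, y))) big1 ?addr0 //.
move=> [x' y'] ne; rewrite (elimT (blockP _ _ _) (fC (x', y'))).
exact: corner_neq.
Qed.

End Blocks.

(** * Coordinates on a block, graded by total exponent *)

Section Coordinates.
Variables (n k : nat) (S : {set 'I_n}) (x y : vert n k).
Local Notation J := {i : 'I_n | i \in S}.
Implicit Types (T : {set J}) (m M : 'X_{1..n}) (q : UCpoly S).

Lemma cornerE (b : BS k S) T :
  (Iel S x * b * Iel S y) T = Bpi (fel (lrepr (b T) (x, y)) x y).
Proof.
have -> : (Iel S x * b * Iel S y) T = Bpi (fel 1 x x) * b T * Bpi (fel 1 y y).
  transitivity ((Iel S x * b) T * Bpi (fel 1 y y)); first exact: sqz_cst_mulr.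
  by congr (_ * _); exact: sqz_cst_mull.
by rewrite -{1}[b T]BpiK -!BpiM fel_corner.
Qed.

Lemma phi_block q : phi x y q \in block S x y.
Proof.
apply/blockP/ffunP=> T.
transitivity (Bpi (fel 1 x x) * phi x y q T * Bpi (fel 1 y y)).
  by rewrite ffunE -!BpiM fel_corner felE !eqxx.
symmetry; transitivity ((Iel S x * phi x y q) T * Bpi (fel 1 y y)).
  exact: sqz_cst_mulr.
by congr (_ * _); exact: sqz_cst_mull.
Qed.

Lemma block_phi a : a \in block S x y -> exists q, a = phi x y q.
Proof.
move/blockP=> aE; exists [ffun T => lrepr (a T) (x, y)].
by apply/ffunP=> T; rewrite [in LHS]aE cornerE !ffunE.
Qed.

Lemma phiB q r : phi x y (q - r) = phi x y q - phi x y r.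
Proof.
apply/ffunP=> T; rewrite !ffunE -[RHS](raddfB (lpi (@Bideal n k))).
congr (lpi _ _); apply/ffunP=> uv; rewrite !ffunE.
by case: eqP; rewrite ?subr0.
Qed.

Lemma dBS_phi q : dBS (phi x y q) = phi x y (sqz_diff (fun j : J => 'X_(val j)) q).
Proof.
apply/ffunP=> T; rewrite !ffunE.
have felD' p r : fel (p + r) x y = fel p x y + fel r x y :> B0 n k by apply: felD.
rewrite (big_morph (fun p => fel p x y) felD' (fel0 x y)) Bpi_sum.
by apply: eq_bigr => j jT; rewrite ffunE -BpiM fel_Uel.
Qed.

(** The monomials that survive in I_x B I_y when [x] and [y] are not far, see [phi_eqP]. *)
Definition alive m := [forall g, generating x y g ==> ~~ (pmon g <= m)%MM].

Lemma phi_eqP (nf : ~~ far x y) q r : phi x y q = phi x y r <->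
  forall T m, alive m -> (q T)@_m = (r T)@_m.
Proof.
have -> : phi x y q = phi x y r <-> phi x y (q - r) = 0.
  by rewrite phiB; split=> [->|/eqP]; rewrite ?subrr // subr_eq0 => /eqP.
split=> [/ffunP qr T m am|qr].
  have := qr T; rewrite !ffunE => /eqP; rewrite Bpi_eq0 => /(fel_Bideal _ nf) dqr.
  apply/eqP; rewrite -subr_eq0 -mcoeffB; apply: contraTT am => /dqr[g gg gm].
  by apply/forallPn; exists g; rewrite gg gm.
apply/ffunP=> T; rewrite !ffunE; apply/eqP; rewrite Bpi_eq0.
apply/(fel_Bideal _ nf) => m; rewrite mcoeffB subr_eq0.
have [/qr->|] := boolP (alive m); first by rewrite eqxx.
by case/forallPn=> g; rewrite negb_imply negbK => /andP[gg gm] _; exists g.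
Qed.

(** The exponents of \prod_(j in T) U_j, which is the degree given to \prod_(j in T) C_j. *)
Definition mset T : 'X_{1..n} := [multinom (i \in val @: T : nat) | i < n].

Lemma mset_in T j : mset T (val j) = (j \in T).
Proof. by rewrite mnmE mem_imset //; apply: val_inj. Qed.

Lemma mset_out T i : i \notin S -> mset T i = 0%N.
Proof. by rewrite mnmE; case: imsetP => [[j _ ->]|//]; rewrite (valP j). Qed.

Lemma mset_leP T M : reflect (forall j, j \in T -> (0 < M (val j))%N) (mset T <= M)%MM.
Proof.
apply: (iffP mnm_lepP) => [le j jT|le i].
  by have := le (val j); rewrite mset_in jT.
by rewrite mnmE; case: imsetP => [[j jT ->]|//]; apply: le.
Qed.

Lemma msetU1 T j : j \notin T -> mset (j |: T) = (U_(val j) + mset T)%MM.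
Proof.
move=> jT; apply/mnmP=> i; rewrite mnmDE mnm1E.
have [iS|iS] := boolP (i \in S); last first.
  rewrite !mset_out // (_ : (_ == i) = false) //.
  by apply: contraNF iS => /eqP <-; exact: valP.
rewrite (_ : i = val (Sub i iS : J)) // !mset_in !inE val_eqE eq_sym.
by case: eqP => [<-|_]; rewrite ?(negbTE jT).
Qed.

(* The coefficient of \prod_(j in T) C_j U^(M - mset T): the differential
   preserves M. *)
Definition dcoef M q : sqz 'F_2 J :=
  [ffun T => if (mset T <= M)%MM then (q T)@_(M - mset T) else 0].

(** The sets [T] that index the nonzero monomials of total exponent [M]. *)
Definition dalive M T : bool := (mset T <= M)%MM && alive (M - mset T)%MM.

Lemma dcoef_out q M T : ~~ (mset T <= M)%MM -> dcoef M q T = 0.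
Proof. by rewrite ffunE => /negbTE->. Qed.

Lemma dcoefB q r M : dcoef M (q - r) = dcoef M q - dcoef M r.
Proof.
by apply/ffunP=> T; rewrite !ffunE; case: ifP; rewrite ?subrr // mcoeffB.
Qed.

Lemma phi_dcoefP (nf : ~~ far x y) q r : phi x y q = phi x y r <->
  forall M T, dalive M T -> dcoef M q T = dcoef M r T.
Proof.
rewrite (phi_eqP nf); split=> [qr M T /andP[TM am]|qr T m am].
  by rewrite !ffunE TM qr.
have TM : (mset T <= m + mset T)%MM by apply/mnm_lepP=> i; rewrite mnmDE leq_addl.
by have := qr (m + mset T)%MM T; rewrite /dalive TM addmK am !ffunE TM addmK; apply.
Qed.

Lemma mcoeffMXU (p : {mpoly 'F_2[n]}) i m :
  (p * 'X_i)@_m = if (U_(i) <= m)%MM then p@_(m - U_(i)) else 0.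
Proof.
case: ifP => im; first by rewrite -{1}(submK im) addmC mcoeffMX.
apply: contraFeq im; rewrite -mcoeff_msupp => /msuppM_le/allpairsP[[m1 m2] /= [_ + ->]].
by rewrite msuppX inE => /eqP->; apply/mnm_lepP=> j; rewrite mnmDE leq_addl.
Qed.

(** In a fixed degree the set [T] determines the exponents of the U_i, so replacing C_j by U_j
    amounts to removing [j] from the set, with coefficient 1. *)
Lemma dcoef_diff q M :
  dcoef M (sqz_diff (fun j : J => 'X_(val j)) q) = sqz_diff (fun=> 1) (dcoef M q).
Proof.
apply/ffunP=> T; rewrite !ffunE; case: ifP => TM.
  rewrite (raddf_sum (mcoeff (M - mset T)%MM)); apply: eq_bigr => j jT.
  rewrite mulr1 ffunE [LHS]mcoeffMXU (msetU1 jT).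
  have -> : (U_(val j) <= M - mset T)%MM = (U_(val j) + mset T <= M)%MM.
    apply/mnm_lepP/mnm_lepP => le i; have := le i; have := mnm_lepP TM i;
      rewrite ?mnmDE ?mnmBE; lia.
  by case: ifP => [_|//]; congr mcoeff; rewrite submDA addmC.
rewrite big1 // => j jT; rewrite mulr1 ffunE msetU1 // ifF //.
apply: contraFF TM => /mnm_lepP le; apply/mnm_lepP=> i.
by apply: leq_trans (le i); rewrite mnmDE leq_addl.
Qed.

(** A section of [dcoef M] on the functions vanishing where [mset T] does not divide [M]. *)
Definition chain M (c : sqz 'F_2 J) : UCpoly S :=
  [ffun T => if (mset T <= M)%MM then c T *: 'X_[M - mset T] else 0].

Lemma dcoef_chain M c M' T :
  dcoef M' (chain M c) T = if (M == M') && (mset T <= M)%MM then c T else 0.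
Proof.
rewrite !ffunE; case: ifP => TM'; last first.
  by case: eqP => // ->; rewrite TM'.
case: ifP => TM; rewrite ?andbF ?mcoeff0 // andbT mcoeffZ mcoeffX.
rewrite (_ : (_ == _) = (M == M')); last first.
  apply/eqP/eqP => [e|->//]; by rewrite -(submK TM) e submK.
by case: eqP; rewrite ?mulr1 ?mulr0.
Qed.

Lemma dcoef_supp q : exists2 s : seq 'X_{1..n}, uniq s &
  forall M T, dcoef M q T != 0 -> M \in s.
Proof.
pose sT T := [seq (m + mset T)%MM | m <- msupp (q T)].
exists (undup (flatten [seq sT T | T <- enum {set J}])).
  exact: undup_uniq.
move=> M T; rewrite ffunE; case: ifP => [TM|]; last by rewrite eqxx.
rewrite -mcoeff_msupp => qT; rewrite mem_undup; apply/flatten_mapP; exists T.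
  by rewrite mem_enum.
by apply/mapP; exists (M - mset T)%MM; rewrite // submK.
Qed.

End Coordinates.

(** * Complexes of subsets over F_2 *)

Section SetComplex.
Variable J : finType.
Implicit Types (T P : {set J}) (j : J) (b c : sqz 'F_2 J).

Local Notation bd := (@sqz_diff 'F_2 J (fun=> 1)).

Lemma bdE c T : bd c T = \sum_(j | j \notin T) c (j |: T).
Proof. by rewrite ffunE; apply: eq_bigr => j _; rewrite mulr1. Qed.

Lemma addff (a : 'F_2) : a + a = 0.
Proof. exact: (F2_addrr (a : ('F_2)^o)). Qed.

Lemma bdK c : bd (bd c) = 0.
Proof. by apply: sqz_diffK => [_ a|]; [rewrite mul1r mulr1 | exact: addff]. Qed.

Definition supported (K : pred {set J}) c := forall T, c T != 0 -> K T.
Definition cyclic (K : pred {set J}) c := forall T, K T -> bd c T = 0.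

(* Subsets outside K count as zero in the complex spanned by K. *)
Definition homologous (K : pred {set J}) c c' :=
  exists2 b, supported K b & forall T, K T -> c T = c' T + bd b T.

(** * Pushing a cycle along a cone *)

Section Cone.
Variables (K : pred {set J}) (c : sqz 'F_2 J) (i : J).
Hypothesis Kconvex : forall T T' P, K T -> K T' -> T \subset P -> P \subset T' -> K P.
Hypothesis cK : supported K c.
Hypothesis c_cyclic : cyclic K c.
Hypothesis KU1 : forall T, K T -> K (i |: T).

(** This is the product C_i c, for which bd (C_i c) = c + C_i (bd c). *)
Definition cone : sqz 'F_2 J := [ffun T : {set J} => if i \in T then c (T :\ i) else 0].

(** In characteristic 2, c + bd (C_i c) = C_i (bd c). Cut down to [K], and with [bd c] zero on [K],
    it lives on the sets that contain [i] and leave [K] when [i] is removed. *)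
Definition coned : sqz 'F_2 J := [ffun T : {set J} => if K T then c T + bd cone T else 0].

Lemma cone_supp : supported K cone.
Proof.
move=> T; rewrite ffunE; case: ifP => iT; last by rewrite eqxx.
by move/cK/KU1; rewrite setD1K.
Qed.

Lemma coned_homologous : homologous K c coned.
Proof.
exists cone; first exact: cone_supp.
by move=> T KT; rewrite ffunE KT -addrA addff addr0.
Qed.

Lemma coned_supp : supported K coned.
Proof. by move=> T; rewrite ffunE; case: ifP; rewrite ?eqxx. Qed.

(** Cutting down to [K] changes no boundary value on [K]: if [T] is in [K] and [j |: T] is not, then
    by convexity no set above [j |: T] is in [K], so the uncut chain vanishes there. *)
Lemma coned_cyclic : cyclic K coned.
Proof.
move=> T KT; transitivity (bd c T + bd (bd cone) T).
  2: by rewrite c_cyclic // bdK ffunE addr0.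
rewrite (bdE coned) (bdE c) (bdE (bd cone)) -big_split /=.
apply: eq_bigr => j jT; rewrite ffunE; case: ifP => // nK.
have cj : c (j |: T) = 0 by apply: contraFeq nK => /cK.
rewrite cj add0r bdE big1 // => l _; apply: contraFeq nK => /cone_supp Kl.
by apply: Kconvex KT Kl _ _; rewrite subsetUr.
Qed.

Lemma bd_cone_in T : i \in T ->
  bd cone T = \sum_(j | j \notin T) c (j |: (T :\ i)).
Proof.
move=> iT; rewrite bdE; apply: eq_bigr => j jT; rewrite ffunE !inE iT orbT.
congr (c _); apply/setP=> t; rewrite !inE.
by case: (eqVneq t i) => [->|//]; case: eqP => // ij; rewrite -ij iT in jT.
Qed.

Lemma coned_out T : i \notin T -> coned T = 0.
Proof.
move=> iT; rewrite ffunE; case: ifP => // KT.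
rewrite bdE (bigD1 i) //= ffunE setU11 setU1K // big1 ?addr0 ?addff // => j /andP[jT ji].
by rewrite ffunE !inE eq_sym (negbTE ji) (negbTE iT).
Qed.

Lemma coned_eq0 T : K (T :\ i) -> coned T = 0.
Proof.
move=> KTi; have [iT|/coned_out//] := boolP (i \in T).
rewrite ffunE; case: ifP => // KT; rewrite bd_cone_in //.
have := c_cyclic KTi; rewrite bdE (bigD1 i) ?setD11 //= setD1K //.
rewrite (eq_bigl (fun j => j \notin T)) // => j; rewrite !inE negb_and negbK.
by case: (eqVneq j i) => [->|]; rewrite ?iT ?andbT.
Qed.

(** The last clause lists the terms of [bd c (T :\ i)], one of which must be nonzero. *)
Lemma coned_neq0 T : coned T != 0 ->
  [/\ i \in T, ~~ K (T :\ i) &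
      c T != 0 \/ exists2 j, j \notin T & c (j |: (T :\ i)) != 0].
Proof.
move=> nz; have iT : i \in T by apply: contraNT nz => /coned_out->.
split=> //; first by apply: contraNN nz => /coned_eq0->.
have [c0|] := eqVneq (c T) 0; last by left.
right; apply/exists_inP; apply: contraNT nz; rewrite negb_exists_in => /forall_inP c0'.
rewrite ffunE; case: ifP => // _; rewrite c0 add0r bd_cone_in // big1 // => j jT.
by apply/eqP; have := c0' j jT; rewrite negbK.
Qed.

End Cone.

Lemma homologous_trans K c c' c'' :
  homologous K c c' -> homologous K c' c'' -> homologous K c c''.
Proof.
move=> [b bK e] [b' bK' e']; exists (b + b') => [T|T KT].
  rewrite ffunE => nz; have [b0|/bK//] := eqVneq (b T) 0.
  by apply: bK'; rewrite b0 add0r in nz.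
rewrite e // e' // -addrA; congr (_ + _).
by rewrite !bdE -big_split addrC; apply: eq_bigr => j _; rewrite ffunE.
Qed.

(** * Tensor products of complexes of nonempty subsets *)

Section Factors.
Variables (I : finType) (A : I -> {set J}) (G : {set I}) (pt : I -> J).
Hypothesis A_disjoint : forall g h j, j \in A g -> j \in A h -> g = h.
Hypothesis ptA : forall g, pt g \in A g.

(* As a complex: the tensor product over g in G of the nonempty subsets of A g. *)
Definition meets_all T : bool :=
  (T \subset \bigcup_(g in G) A g) && [forall g in G, T :&: A g != set0].

Lemma meets_all_convex T T' P :
  meets_all T -> meets_all T' -> T \subset P -> P \subset T' -> meets_all P.
Proof.
move=> /andP[_ /forall_inP mT] /andP[T'c _] TP PT'.
apply/andP; split; first exact: subset_trans T'c.
apply/forall_inP=> g /mT; apply: contraNneq => P0.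
by rewrite -subset0 -P0 setSI.
Qed.

Lemma meets_allU1 g T : g \in G -> meets_all T -> meets_all (pt g |: T).
Proof.
move=> gG /andP[Tc /forall_inP mT]; apply/andP; split.
  by rewrite subUset Tc andbT sub1set; apply/bigcupP; exists g.
apply/forall_inP=> h /mT; apply: contraNneq => P0.
by rewrite -subset0 -P0 setSI // subsetUr.
Qed.

(** Coning at [pt g] for each [g] in turn: each cone normalizes the intersection with [A g] and
    preserves those already normalized. *)
Lemma homologous_points c (s : seq I) : {subset s <= G} ->
    supported meets_all c -> cyclic meets_all c ->
  exists c', [/\ supported meets_all c', cyclic meets_all c',
    homologous meets_all c c' &
    forall T, c' T != 0 -> forall g, g \in s -> T :&: A g = [set pt g]].
Proof.
move=> + cK cc; elim: s => [|g s IH] sG.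
  exists c; split=> //; exists 0 => [T|T _]; first by rewrite ffunE eqxx.
  by rewrite bdE big1 ?addr0 // => j _; rewrite ffunE.
have [|c' [cK' cc' hc cs]] := IH; first by move=> h hs; rewrite sG // inE hs orbT.
have gG : g \in G by rewrite sG // inE eqxx.
exists (coned meets_all c' (pt g)).
have KU1 := fun T => @meets_allU1 g T gG.
split; first exact: coned_supp.
- exact: coned_cyclic meets_all_convex cK' cc' KU1.
- exact: homologous_trans hc (coned_homologous cK' KU1).
move=> T nz; have /(coned_neq0 cc')[ptT nK nz'] := nz.
have /andP[Tc /forall_inP mT] := coned_supp nz.
(* Without [pt g] the set [T] leaves the complex, so it misses some [A h]; only [A g] contains
   [pt g], hence [h = g]. *)
have [h hG Th] : exists2 h, h \in G & (T :\ pt g) :&: A h = set0.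
  move: nK; rewrite negb_and (subset_trans (subsetDl _ _) Tc) /=.
  by case/forall_inPn=> h hG; rewrite negbK => /eqP; exists h.
have gh : g = h.
  have /set0Pn[t] := mT h hG; rewrite inE => /andP[tT th].
  apply: A_disjoint (ptA g) _; have [<-//|ne] := eqVneq t (pt g).
  by move/setP: Th => /(_ t); rewrite !inE ne tT th.
rewrite -{}gh in Th.
move=> h'; rewrite inE => /orP[/eqP->|h's].
  apply/setP=> t; move/setP: Th => /(_ t); rewrite !inE.
  by case: eqP => // ->; rewrite ptT ptA.
have [->|hg] := eqVneq h' g.
  apply/setP=> t; move/setP: Th => /(_ t); rewrite !inE.
  by case: eqP => // ->; rewrite ptT ptA.
case: nz' => [/cs|[j jT nz']]; first by apply.
(* The set [j |: (T :\ pt g)] must meet [A g], and only [j] can lie there. So it agrees with [T] on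
   every other factor. *)
have jg : j \in A g.
  have /andP[_ /forall_inP/(_ g gG)/set0Pn[t]] := cK' _ nz'.
  rewrite !inE => /andP[/orP[/eqP->//|tT] tg].
  by move/setP: Th => /(_ t); rewrite !inE tT tg.
rewrite -(cs _ nz' _ h's); apply/setP=> t; rewrite !inE.
have [th|] := boolP (t \in A h'); rewrite ?andbF // !andbT.
have -> : (t == j) = false.
  by apply: contraNF hg => /eqP tj; rewrite (A_disjoint th (_ : t \in A g)) // tj.
have -> // : t != pt g.
by apply: contraNneq hg => tp; rewrite (A_disjoint th (_ : t \in A g)) // tp.
Qed.

(** Once every factor is normalized, the only set left in the support is the transversal
    [pt @: G]. *)
Lemma homologous_point c : supported meets_all c -> cyclic meets_all c ->
  exists a : 'F_2, homologous meets_all c (sqz_mon a (pt @: G)).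
Proof.
move=> cK cc; have [s|c' [cK' cc' hc cs]] := homologous_points (s := enum G) _ cK cc.
  by rewrite mem_enum.
exists (c' (pt @: G)); suff <- : c' = sqz_mon (c' (pt @: G)) (pt @: G) by [].
apply/ffunP=> T; rewrite ffunE; case: eqP => [->//|TG].
apply: contra_notP TG => /eqP nz; have /andP[Tc _] := cK' _ nz.
apply/setP=> t; apply/idP/imsetP=> [tT|[g gG ->]].
  have /bigcupP[g gG tg] := subsetP Tc t tT; exists g => //.
  by apply/set1P; rewrite -(cs _ nz g) ?mem_enum // inE tT.
have : pt g \in [set pt g] by rewrite inE.
by rewrite -(cs _ nz g) ?mem_enum // inE => /andP[].
Qed.

(** Transversals. Summing coefficients over them is the functional that detects homology: it kills
    boundaries and is 1 on the transversal of chosen points. *)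
Definition meets_once T : bool :=
  (T \subset \bigcup_(g in G) A g) && [forall g in G, #|T :&: A g| == 1%N].

Lemma meets_once_points : meets_once (pt @: G).
Proof.
apply/andP; split.
  by apply/subsetP=> _ /imsetP[g gG ->]; apply/bigcupP; exists g.
apply/forall_inP=> g gG; apply/cards1P; exists (pt g).
apply/setP=> t; rewrite !inE; apply/andP/eqP=> [[/imsetP[h hG ->] hg]|->].
  by rewrite (A_disjoint hg (ptA h)).
by rewrite imset_f.
Qed.

Lemma meets_once_meets T : meets_once T -> meets_all T.
Proof.
case/andP=> Tc /forall_inP mT; rewrite /meets_all Tc.
by apply/forall_inP=> g /mT; apply: contraTneq => ->; rewrite cards0.
Qed.

(* A set containing a transversal and one more point contains exactly two. *)
Lemma sum_meets_once_bd c :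
  (forall T, c T != 0 -> T \subset \bigcup_(g in G) A g) ->
  \sum_(T | meets_once T) bd c T = 0.
Proof.
move=> cG; under eq_bigr => T _ do rewrite bdE.
(* Count by [P = j |: T]: each [c P] appears once for every point of [P] whose removal leaves a
   transversal. *)
transitivity (\sum_(P : {set J}) \sum_(j | (j \in P) && meets_once (P :\ j)) c P).
  rewrite [RHS](exchange_big_dep predT) //= (exchange_big_dep predT) //=.
  apply: eq_bigr => j _.
  rewrite [RHS](reindex_onto (fun T => j |: T) (fun P => P :\ j)) /=; last first.
    by move=> P /andP[jP _]; rewrite setD1K.
  apply: eq_bigl => T; rewrite setU11 /=.
  have [jT|jT] := boolP (j \in T); last by rewrite setU1K // eqxx !andbT.
  by rewrite andbF; apply/esym/negP => /andP[_ /eqP TE]; rewrite -TE !inE eqxx in jT.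
apply: big1 => P _; have [c0|/cG Pc] := eqVneq (c P) 0; first by rewrite c0 big1.
have [[j /andP[jP tj]]|none] :=
  pselect (exists j, (j \in P) && meets_once (P :\ j)); last first.
  by rewrite big_pred0 // => j; apply/negP => jj; apply: none; exists j.
have /bigcupP[g gG jg] := subsetP Pc j jP.
have /andP[_ /forall_inP mj] := tj.
(* [j] and [t] are the two points of [P] in [A g]; removing either one leaves a transversal, and the
   two equal terms cancel. *)
have /cards1P[t tE] := mj g gG.
have : t \in [set t] by rewrite inE.
rewrite -tE !inE => /andP[/andP[tne tP] tg].
have PgE : P :&: A g = [set j; t].
  apply/setP=> l; move/setP: tE => /(_ l); rewrite !inE.
  by case: (eqVneq l j) => [->|//] _; rewrite jP jg.
have PhE l h : h != g -> l \in A g -> (P :\ l) :&: A h = P :&: A h.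
  move=> hg lg; apply/setP=> u; rewrite !inE; case: (eqVneq u l) => [->|//].
  case lh: (l \in A h); rewrite ?andbF //.
  by rewrite (A_disjoint lh lg) eqxx in hg.
have tt : meets_once (P :\ t).
  apply/andP; split; first exact: subset_trans (subsetDl _ _) Pc.
  apply/forall_inP=> h hG; have [->|hg] := eqVneq h g.
    apply/cards1P; exists j; apply/setP=> l; move/setP: PgE => /(_ l); rewrite !inE.
    by case: (eqVneq l t) => [->|/=]; rewrite ?(negbTE tne) // orbF.
  by have := mj h hG; rewrite !PhE.
rewrite (bigD1 j) ?jP //= (bigD1 t) ?tP ?tt //= big1 ?addr0 ?addff //.
(* Removing a third point would leave both [j] and [t] in [A g]. *)
move=> l /andP[/andP[/andP[lP /andP[_ /forall_inP/(_ g gG)/cards1P[u uE]]] lj] lt].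
have : j \in [set u] by rewrite -uE !inE jP jg eq_sym lj.
have : t \in [set u] by rewrite -uE !inE tP tg eq_sym lt.
by rewrite !inE => /eqP tu /eqP ju; rewrite tu ju eqxx in tne.
Qed.

End Factors.
End SetComplex.

(** * Homology classes *)

Section HomologyClasses.
Variables (K : nzRingType) (V : lmodType K) (d : {linear V -> V}).
Variable C : submodClosed V.
Hypothesis dK : forall v, d (d v) = 0.
Local Notation Z := (cycles d C).
Local Notation cls := (hclass d C).

Lemma cyclesE v : (v \in Z) = (v \in C) && (d v == 0).
Proof. by []. Qed.

Lemma hclassP c u v : u \in Z -> v \in Z -> cls (c *: u + v) = c *: cls u + cls v.
Proof.
move=> Zu Zv; rewrite /hclass -linearP; congr (lpi _ _); apply: val_inj.
have Zc : c *: u + v \in Z by rewrite rpredD // rpredZ.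
by rewrite linearP /= !(insubdK _ Zu, insubdK _ Zv, insubdK _ Zc).
Qed.

Lemma hclass0 : cls 0 = 0.
Proof.
rewrite /hclass (_ : insubd _ _ = 0) ?raddf0 //; apply: val_inj.
by rewrite insubdK ?rpred0 // raddf0.
Qed.

Lemma hclass_sum (I : eqType) (r : seq I) (c : I -> K) (F : I -> V) :
  (forall i, i \in r -> F i \in Z) ->
  \sum_(i <- r) c i *: F i \in Z /\
  cls (\sum_(i <- r) c i *: F i) = \sum_(i <- r) c i *: cls (F i).
Proof.
elim: r => [|i r IH] Zr; first by rewrite !big_nil rpred0 hclass0.
have Zi : F i \in Z by rewrite Zr // mem_head.
have [|Zs cs] := IH; first by move=> j jr; rewrite Zr // inE jr orbT.
by rewrite !big_cons hclassP // cs rpredD // rpredZ.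
Qed.

Lemma hclass_homologous u v w : v \in Z -> w \in C -> d w \in C -> u = v + d w ->
  u \in Z /\ cls u = cls v.
Proof.
move=> Zv Cw Cdw ->; have Zdw : d w \in Z by rewrite cyclesE Cdw dK eqxx.
split; first exact: rpredD.
rewrite addrC -[d w]scale1r hclassP // scale1r -[RHS]add0r; congr (_ + _).
apply/eqP; rewrite lpi_eq0; apply/asboolP; exists w => //.
by rewrite insubdK.
Qed.

Lemma hclass_eq0 u : u \in Z -> cls u = 0 -> exists2 w, w \in C & u = d w.
Proof.
move=> Zu /eqP; rewrite lpi_eq0 => /asboolP[w Cw].
by rewrite insubdK // => ->; exists w.
Qed.

Lemma hclass_surj (h : homology d C) : exists2 u, u \in Z & h = cls u.
Proof.
exists (val (lrepr h)); first exact: valP.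
by rewrite /hclass valKd lreprK.
Qed.

End HomologyClasses.

Lemma sum_span (K : nzRingType) (V : lmodType K) (I : eqType) (P : pred I)
    (e : I -> V) (r : seq I) : all P r ->
  exists2 s : seq I, all P s &
    exists c : I -> K, \sum_(i <- r) e i = \sum_(i <- s) c i *: e i.
Proof.
move=> Pr; exists (undup r).
  by apply/allP=> i; rewrite mem_undup; apply: (allP Pr).
exists (fun i => (count_mem i r)%:R); rewrite -big_undup_iterop_count.
by apply: eq_bigr => i _; rewrite scaler_nat.
Qed.

(** * The basis elements *)

Lemma prod_sqz_mon (A : comPzRingType) (I J : finType) (u : I -> A) (f : I -> J)
    (s : seq I) : injective f -> uniq s ->
  \prod_(g <- s) sqz_mon (u g) [set f g] =
  sqz_mon (\prod_(g <- s) u g) (f @: [set:: s]) :> sqz A J.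
Proof.
move=> f_inj; elim: s => [|g s IH] => [_|/= /andP[gs us]].
  by rewrite !big_nil set_nil imset0.
rewrite !big_cons IH // set_cons imsetU1 sqz_monM // disjoints1.
by rewrite mem_imset // inE.
Qed.

Section BasisElements.
Variables (n k : nat) (S : {set 'I_n}) (x y : vert n k).
Local Notation J := {i : 'I_n | i \in S}.
Local Notation I := (genS S x y).
Variable ic : I -> J.
Hypothesis icP : forall g, val (ic g) \in lines (val g).
Implicit Types (T : {set J}) (m M : 'X_{1..n}) (G : {set I}) (g : I) (j : J).

Definition slines g : {set J} := [set j | val j \in lines (val g)].

Lemma in_slines g j : (j \in slines g) = (val j \in lines (val g)).
Proof. exact: in_set. Qed.

Lemma genS_generating g : generating x y (val g).
Proof. by case/andP: (valP g). Qed.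

Lemma genS_disjoint g g' i :
  i \in lines (val g) -> i \in lines (val g') -> g = g'.
Proof.
move=> ig ig'; apply: val_inj.
exact: generating_disjoint (genS_generating g) (genS_generating g') ig ig'.
Qed.

Lemma slines_disjoint g g' j : j \in slines g -> j \in slines g' -> g = g'.
Proof. by rewrite !in_slines; apply: genS_disjoint. Qed.

Lemma ic_slines g : ic g \in slines g.
Proof. by rewrite in_slines. Qed.

Lemma ic_inj : injective ic.
Proof.
by move=> g g' e; apply: (slines_disjoint (ic_slines g)); rewrite e ic_slines.
Qed.

(** The total exponent of a basis element: C_i p / U_i has the degree of p. *)
Definition deg G m : 'X_{1..n} := (m + \sum_(g in G) pmon (val g))%MM.

Lemma degE G m i : deg G m i = (m i + [exists g in G, i \in lines (val g)])%N.
Proof.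
rewrite mnmDE mnm_sumE; congr (_ + _)%N.
case: exists_inP => [[g gG ig]|none].
  rewrite (bigD1 g) //= mnmE ig big1 // => g' /andP[_ g'g]; rewrite mnmE.
  by case: (boolP (i \in _)) => // ig'; rewrite (genS_disjoint ig ig') eqxx in g'g.
apply: big1 => g gG; rewrite mnmE; case: (boolP (i \in _)) => // ig.
by case: none; exists g.
Qed.

Lemma cover_slines G j :
  (j \in \bigcup_(g in G) slines g) = [exists g in G, val j \in lines (val g)].
Proof.
apply/bigcupP/exists_inP => -[g gG jg]; exists g => //; first by rewrite in_slines in jg.
by rewrite in_slines.
Qed.

Definition basis_poly (eps : {ffun I -> bool}) m : UCpoly S :=
  Upoly S 'X_[m] * \prod_(g : I)
    (Cvar (ic g) * Upoly S 'X_[pmon (val g) - U_(val (ic g))]) ^+ eps g.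

(** The chosen lines are distinct, so the product is a single monomial, with C-part [ic @: G]. *)
Lemma basis_polyE (eps : {ffun I -> bool}) m :
  let G := [set g | eps g] in
  basis_poly eps m = chain (deg G m) (sqz_mon 1 (ic @: G)).
Proof.
move=> G; rewrite /basis_poly.
have -> : \prod_(g : I)
      (Cvar (ic g) * Upoly S 'X_[pmon (val g) - U_(val (ic g))]) ^+ eps g =
    sqz_mon (\prod_(g in G) 'X_[pmon (val g) - U_(val (ic g))]) (ic @: G) :> UCpoly S.
  transitivity (\prod_(g <- enum G)
      (sqz_mon 'X_[pmon (val g) - U_(val (ic g))] [set ic g] : UCpoly S)).
    rewrite big_enum /= [RHS]big_mkcond; apply: eq_bigr => g _.
    rewrite inE; case: (eps g); rewrite ?expr0 // expr1.
    by rewrite [LHS]sqz_monM ?disjoints1 ?inE // mul1r setU0.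
  rewrite (prod_sqz_mon _ ic_inj) ?enum_uniq // big_enum /=.
  by rewrite (_ : [set:: enum G] = G) //; apply/setP=> g; rewrite inE mem_enum.
rewrite [LHS]sqz_monM ?disjoint_sets0 // ?set0U; last first.
  by rewrite -setI_eq0 set0I.
rewrite mprodXE -mpolyXD; apply/ffunP=> T; rewrite !ffunE.
case: eqP => [->|_]; last by rewrite scale0r if_same.
suff -> : deg G m =
    (m + \sum_(g in G) (pmon (val g) - U_(val (ic g))) + mset (ic @: G))%MM.
  rewrite addmK scale1r ifT //; apply/mnm_lepP=> i; rewrite mnmDE; exact: leq_addl.
rewrite -addmA; congr (_ + _)%MM; apply/mnmP=> i.
rewrite mnmDE !mnm_sumE.
have -> : mset (ic @: G) i = (\sum_(g in G) U_(val (ic g))%MM i)%N.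
  rewrite mnmE; case: imsetP => [[j /imsetP[g gG ->] ->]|none].
    rewrite (bigD1 g) //= mnm1E eqxx big1 // => g' /andP[_ g'g].
    rewrite mnm1E; case: eqP => // /val_inj/ic_inj e; by rewrite e eqxx in g'g.
  rewrite big1 // => g gG; rewrite mnm1E; case: eqP => // e; case: none.
  by exists (ic g); rewrite ?imset_f.
rewrite -big_split; apply: eq_bigr => g gG /=; rewrite mnmBE subnK //.
by rewrite mnm1E mnmE; case: eqP => // <-; rewrite icP.
Qed.

Lemma basis_eltE (eps : {ffun I -> bool}) m :
  basis_elt ic eps m = phi x y (chain (deg [set g | eps g] m)
                                  (sqz_mon 1 (ic @: [set g | eps g]))).
Proof. by rewrite -basis_polyE. Qed.

(** * Degrees of the basis elements *)

Section Admissible.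
Variables (G : {set I}) (m : 'X_{1..n}).
Hypothesis adm : admissible S x y m.

Lemma adm_S j : m (val j) = 0%N.
Proof. by case/andP: adm => /forall_inP/(_ _ (valP j))/eqP. Qed.

Lemma adm_alive : alive x y m.
Proof. by case/andP: adm. Qed.

Lemma deg_S j : deg G m (val j) = (j \in \bigcup_(g in G) slines g).
Proof. by rewrite degE adm_S cover_slines. Qed.

Lemma mset_deg T : (mset T <= deg G m)%MM = (T \subset \bigcup_(g in G) slines g).
Proof.
apply/mset_leP/subsetP => h j /h; rewrite deg_S; last by move->.
by case: (j \in _).
Qed.

Lemma deg_away (h : 'I_n.+1 * 'I_n.+1) i : generating x y h ->
  (forall g, g \in G -> val g != h) -> i \in lines h -> deg G m i = m i.
Proof.
move=> gh hG ih; rewrite degE; case: exists_inP => [[g gG ig]|]; last by rewrite addn0.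
have /eqP := generating_disjoint (genS_generating g) gh ig ih.
by rewrite (negbTE (hG g gG)).
Qed.

(** On the lines of an interval outside [G] the degree equals [m], which no p_a divides. *)
Lemma pmon_away (h : 'I_n.+1 * 'I_n.+1) M : generating x y h ->
  (forall g, g \in G -> val g != h) -> (M <= deg G m)%MM -> (pmon h <= M)%MM -> False.
Proof.
move=> gh hG /mnm_lepP MG /mnm_lepP hM.
have /forallP/(_ h) := adm_alive; rewrite gh /= => /negP; apply; apply/mnm_lepP=> i.
rewrite mnmE; case: (boolP (i \in _)) => // ih.
rewrite -(deg_away gh hG ih); apply: leq_trans (MG i); apply: leq_trans (hM i).
by rewrite mnmE ih.
Qed.

Lemma mem_deg g : (g \in G) = (pmon (val g) <= deg G m)%MM.
Proof.
apply/idP/idP => [gG|le].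
  apply/mnm_lepP=> i; rewrite mnmE; case: (boolP (i \in _)) => // ig.
  by rewrite degE (_ : [exists g0 in G, _]) ?leq_addl //; apply/exists_inP; exists g.
apply/negPn/negP => gG; apply: (pmon_away (genS_generating g) _ _ le) => [g' g'G|].
  2: exact/mnm_lepP.
by apply: contraNneq gG => /val_inj <-.
Qed.

(** In this degree every line of S has exponent 0 or 1, so removing [mset T] destroys divisibility
    by p_g exactly when [T] meets the interval [g]; the intervals outside [G] do not divide to begin
    with. *)
Lemma dalive_deg T : dalive x y (deg G m) T = meets_all slines G T.
Proof.
rewrite /dalive /meets_all mset_deg; apply: andb_id2l => Tc.
apply/forallP/forall_inP => [al g gG|mT h].
  have := al (val g); rewrite genS_generating /=.
  apply: contraNneq => Tg; apply/mnm_lepP=> i; rewrite mnmE.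
  case: (boolP (i \in _)) => // ig.
  have := gG; rewrite mem_deg => /mnm_lepP/(_ i); rewrite mnmE ig mnmBE.
  rewrite [mset T i]mnmE; case: imsetP => [[j jT ij]|]; last by rewrite subn0.
  by move/setP: Tg => /(_ j); rewrite in_setI in_set0 jT in_slines -ij ig.
apply/implyP=> gh; apply/negP => le.
have [/exists_inP[g gG /eqP gE]|/exists_inPn none] := boolP [exists g in G, val g == h].
  have /set0Pn[j] := mT g gG; rewrite in_setI in_slines => /andP[jT jg].
  have := mnm_lepP le (val j); rewrite mnmE -gE jg mnmBE mset_in jT deg_S.
  by case: (j \in _).
by apply: (pmon_away gh none) le; apply/mnm_lepP=> i; rewrite mnmBE leq_subr.
Qed.

End Admissible.

(** Distinct labels sit in distinct degrees, since [G] is read off from divisibility by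
    [mem_deg]. *)
Lemma deg_inj G m G' m' : admissible S x y m -> admissible S x y m' ->
  deg G m = deg G' m' -> G = G' /\ m = m'.
Proof.
move=> am am' e.
have GG : G = G' by apply/setP=> g; rewrite (mem_deg G am) (mem_deg G' am') e.
by split=> //; move: e; rewrite /deg GG => /(can_inj (@addmK _ _)).
Qed.

End BasisElements.

HB.instance Definition _ n k S (x y : vert n k) :=
  GRing.isZmodMorphism.Build (UCpoly S) (BS k S) (phi x y) (phiB x y).
HB.instance Definition _ n (S : {set 'I_n}) M :=
  GRing.isZmodMorphism.Build (UCpoly S) (sqz 'F_2 {i : 'I_n | i \in S})
    (dcoef M) (fun q r => dcoefB q r M).

(** * Spanning and independence, degree by degree *)

Section Main.
Variables (n k : nat) (S : {set 'I_n}) (x y : vert n k).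
Local Notation J := {i : 'I_n | i \in S}.
Local Notation I := (genS S x y).
Local Notation Z := (cycles (@dBS n k S) (block S x y)).
Local Notation cls := (hclass (@dBS n k S) (block S x y)).
Local Notation K := (dalive x y).
Hypothesis nf : ~~ far x y.
Implicit Types (T P : {set J}) (m M : 'X_{1..n}) (c : sqz 'F_2 J) (q : UCpoly S).

Lemma alive_le m m' : (m' <= m)%MM -> alive x y m -> alive x y m'.
Proof.
move=> /mnm_lepP le /forallP am; apply/forallP=> g; apply/implyP=> gg.
apply: contraNN (implyP (am g) gg) => /mnm_lepP gm; apply/mnm_lepP=> i.
exact: leq_trans (gm i) (le i).
Qed.

Lemma msetS T T' : T \subset T' -> (mset T <= mset T')%MM.
Proof.
move=> TT'; apply/mset_leP => j /(subsetP TT') jT'.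
by rewrite mset_in jT'.
Qed.

Lemma dalive_convex M T T' P :
  K M T -> K M T' -> T \subset P -> P \subset T' -> K M P.
Proof.
move=> /andP[_ aT] /andP[/mnm_lepP T'M _] TP PT'; apply/andP; split.
  by apply/mnm_lepP=> i; apply: leq_trans (T'M i); apply/mnm_lepP/msetS.
apply: alive_le aT; apply/mnm_lepP=> i; rewrite !mnmBE leq_sub2l //.
exact/mnm_lepP/msetS.
Qed.

Lemma cycles_phi q : phi x y q \in Z <-> forall M, cyclic (K M) (dcoef M q).
Proof.
have -> : (phi x y q \in Z) =
    (phi x y (sqz_diff (fun j : J => 'X_(val j)) q) == phi x y 0).
  by rewrite cyclesE phi_block /= dBS_phi raddf0.
split=> [/eqP/(phi_dcoefP nf) e M T KT|cyc].
  by rewrite -dcoef_diff e // (raddf0 (dcoef M)) ffunE.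
apply/eqP/(phi_dcoefP nf) => M T KT.
by rewrite dcoef_diff cyc // (raddf0 (dcoef M)) ffunE.
Qed.

Lemma dcoef_chain_supp M c M' : supported (K M) c ->
  dcoef M' (chain M c) = if M == M' then c else 0.
Proof.
move=> cK; apply/ffunP=> T; rewrite dcoef_chain.
case: eqP => _ /=; last by rewrite ffunE.
case: ifP => // TM; apply/esym; apply: contraFeq TM => /cK.
by case/andP.
Qed.

Lemma chain_cycle M c : supported (K M) c -> cyclic (K M) c ->
  phi x y (chain M c) \in Z.
Proof.
move=> cK cc; apply/cycles_phi => M'; rewrite dcoef_chain_supp //.
case: eqP => [<-//|_] T _; rewrite bdE big1 // => j _; exact: ffunE.
Qed.

Lemma hclass_chain M c c' : supported (K M) c -> supported (K M) c' ->
    cyclic (K M) c' -> homologous (K M) c c' ->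
  cls (phi x y (chain M c)) = cls (phi x y (chain M c')).
Proof.
move=> cK cK' cc' [b bK e].
have [] // := @hclass_homologous _ _ (@dBS n k S) (block S x y) (@dBSK n k S)
  (phi x y (chain M c)) (phi x y (chain M c')) (phi x y (chain M b)).
- exact: chain_cycle.
- exact: phi_block.
- by rewrite /= dBS_phi phi_block.
rewrite /= dBS_phi -raddfD; apply/(phi_dcoefP nf) => M' T KT.
rewrite (raddfD (dcoef M')) /= dcoef_diff !dcoef_chain_supp //.
case: eqP KT => [<- /e ->|_ _]; rewrite [RHS]ffunE //.
by rewrite bdE big1 ?addr0 // => j _; exact: ffunE.
Qed.

(** Dropping the coefficients of monomials that vanish in the block makes the chain supported on the
    complex. *)
Definition restr M q : sqz 'F_2 J :=
  [ffun T : {set J} => if K M T then dcoef M q T else 0].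

Lemma restr_supp M q : supported (K M) (restr M q).
Proof. by move=> T; rewrite ffunE; case: ifP; rewrite ?eqxx. Qed.

(** If [T] survives and [j |: T] does not, then [mset (j |: T)] does not divide [M], so the dropped
    coefficient was already zero. *)
Lemma restr_cyclic M q : cyclic (K M) (dcoef M q) -> cyclic (K M) (restr M q).
Proof.
move=> cyc T KT; rewrite -(cyc T KT) !bdE; apply: eq_bigr => j jT.
rewrite [LHS]ffunE; case: ifP => // nK; symmetry; apply: dcoef_out.
apply: contraFN nK => jTM; rewrite /dalive jTM.
case/andP: KT => _; apply: alive_le; apply/mnm_lepP=> i; rewrite !mnmBE leq_sub2l //.
by apply/mnm_lepP/msetS/subsetUr.
Qed.

Lemma phi_sum_chain q (s : seq 'X_{1..n}) : uniq s ->
    (forall M T, dcoef M q T != 0 -> M \in s) ->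
  phi x y q = \sum_(M <- s) phi x y (chain M (restr M q)).
Proof.
move=> us sP; rewrite -raddf_sum; apply/(phi_dcoefP nf) => M T KT.
rewrite (raddf_sum (dcoef M)) sum_ffunE.
have [Ms|Ms] := boolP (M \in s); last first.
  rewrite big1_seq => [|M' /= M's].
    by apply/eqP; apply: contraNT Ms => /sP.
  rewrite dcoef_chain_supp; last exact: restr_supp.
  by case: eqP => [e|_]; [rewrite -e M's in Ms | rewrite ffunE].
rewrite (bigD1_seq M Ms us) /= [in X in _ = X + _]dcoef_chain_supp; last exact: restr_supp.
rewrite eqxx [X in _ = X + _]ffunE KT big1 ?addr0 // => M' /negbTE M'M.
rewrite dcoef_chain_supp; last exact: restr_supp.
by rewrite M'M ffunE.
Qed.

Variable ic : I -> J.
Hypothesis icP : forall g, val (ic g) \in lines (val g).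
Local Notation label := ({ffun I -> bool} * 'X_{1..n})%type.
Local Notation adm := (fun e : label => admissible S x y e.2).

Implicit Types (e : label).

Definition ldeg (e : label) := deg [set g | e.1 g] e.2.
Definition lpts (e : label) : {set J} := ic @: [set g | e.1 g].

Lemma ldeg_inj e e' : adm e -> adm e' -> ldeg e = ldeg e' -> e = e'.
Proof.
case: e e' => [eps m] [eps' m'] /= a a' /(deg_inj a a')[/setP G ->].
by congr pair; apply/ffunP=> g; have := G g; rewrite !inE.
Qed.

Lemma lpts_meets_once e :
  meets_once (@slines n k S x y) [set g | e.1 g] (lpts e).
Proof. exact: meets_once_points (@slines_disjoint _ _ _ _ _) (ic_slines icP). Qed.

Lemma basis_supp e : adm e -> supported (K (ldeg e)) (sqz_mon 1 (lpts e)).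
Proof.
move=> ae T; rewrite ffunE; case: (T =P lpts e) => [-> _|]; last by rewrite eqxx.
by rewrite dalive_deg //; apply/meets_once_meets/lpts_meets_once.
Qed.

(** A transversal with one point removed misses an interval, so it is not in the complex. *)
Lemma basis_cyclic e : adm e -> cyclic (K (ldeg e)) (sqz_mon 1 (lpts e)).
Proof.
move=> ae T; rewrite dalive_deg // => /andP[_ /forall_inP mT].
rewrite bdE big1 // => j jT; rewrite ffunE; case: eqP => // e'.
have : j \in lpts e by rewrite -e' setU11.
case/imsetP=> g gG jg; have /set0Pn[t] := mT g gG.
rewrite in_setI => /andP[tT tg].
have : t \in lpts e by rewrite -e' inE tT orbT.
case/imsetP=> g' g'G tg'; have := slines_disjoint tg.
rewrite {1}tg' => /(_ _ (ic_slines icP g')) gg'.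
by move: jT; rewrite jg gg' -tg' tT.
Qed.

Lemma basis_cycle e : adm e -> basis_elt ic e.1 e.2 \in Z.
Proof.
move=> ae; rewrite basis_eltE //.
exact: chain_cycle (basis_supp ae) (basis_cyclic ae).
Qed.

(** Coefficients are in F_2, so plain sums suffice. *)
Definition spanned (h : homology (@dBS n k S) (block S x y)) : Prop :=
  exists2 r : seq label, all adm r & h = \sum_(e <- r) cls (basis_elt ic e.1 e.2).

Lemma spanned0 : spanned 0.
Proof. by exists [::]; rewrite ?big_nil. Qed.

Lemma spanned_sum (A : eqType) (r : seq A)
    (F : A -> homology (@dBS n k S) (block S x y)) :
  (forall a, a \in r -> spanned (F a)) -> spanned (\sum_(a <- r) F a).
Proof.
elim: r => [|a r IH] Fr; first by rewrite big_nil; apply: spanned0.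
have [s sa sE] := Fr a (mem_head _ _).
have [|s' sa' sE'] := IH; first by move=> b br; apply: Fr; rewrite inE br orbT.
exists (s ++ s'); first by rewrite all_cat sa.
by rewrite big_cons big_cat /= -sE -sE'.
Qed.

Lemma hclass_chain0 M c : (forall T, K M T -> c T = 0) -> cls (phi x y (chain M c)) = 0.
Proof.
move=> c0; rewrite (_ : phi x y _ = phi x y 0); first by rewrite raddf0 hclass0.
apply/(phi_dcoefP nf) => M' T KT; rewrite dcoef_chain (raddf0 (dcoef M')) ffunE.
by case: eqP KT => //= <- /c0 ->; rewrite if_same.
Qed.

Lemma spanned_chain M c : supported (K M) c -> cyclic (K M) c ->
  spanned (cls (phi x y (chain M c))).
Proof.
move=> cK cc.
(* At a line of S with exponent 1, taking C_j instead of U_j stops p_g from dividing. *)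
pose hit (g : 'I_n.+1 * 'I_n.+1) (j : J) :=
  [&& generating x y g, (pmon g <= M)%MM, val j \in lines g & M (val j) == 1%N].
(* First case: p_g divides [M] and nothing hits [g]. Every [T] leaves p_g dividing, so the complex
   is zero. *)
have [/existsP[g /and3P[gg gM /forallP nohit]]|/existsPn hit_gen] :=
  boolP [exists g, [&& generating x y g, (pmon g <= M)%MM & [forall j, ~~ hit g j]]].
  rewrite hclass_chain0; first exact: spanned0.
  move=> T /andP[/mset_leP TM /forallP/(_ g)]; rewrite gg /= => /negP[].
  apply/mnm_lepP=> i; rewrite mnmE; case: (boolP (i \in _)) => // ig.
  rewrite mnmBE [mset T i]mnmE; have := mnm_lepP gM i; rewrite mnmE ig.
  case: imsetP => [[j jT ij]|]; last by rewrite subn0.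
  have := nohit j; rewrite /hit gg gM -ij ig /=; lia.
(* Second case: some line [j] of S in the support of [M] hits nothing. Then [j] can be freely added
   to or removed from a set of the complex, and coning at [j] kills the cycle. *)
have [/existsP[j /andP[jM /forallP nohit]]|/existsPn hit_line] :=
  boolP [exists j : J, (0 < M (val j))%N && [forall g, ~~ hit g j]].
  have KU1 T : K M T -> K M (j |: T).
    case/andP=> /mset_leP TM aT; apply/andP; split.
      by apply/mset_leP => t; rewrite !inE => /orP[/eqP->|/TM].
    apply: alive_le aT; apply/mnm_lepP=> i; rewrite !mnmBE leq_sub2l //.
    exact/mnm_lepP/msetS/subsetUr.
  have KD1 T : K M T -> K M (T :\ j).
    case/andP=> /mset_leP TM aT; apply/andP; split.
      by apply/mset_leP => t; rewrite !inE => /andP[_ /TM].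
    apply/forallP=> g; apply/implyP=> gg; apply/negP => gle.
    have /negP[] := implyP (forallP aT g) gg; apply/mnm_lepP=> i.
    rewrite mnmE; case: (boolP (i \in _)) => // ig.
    have := mnm_lepP gle i; rewrite mnmE ig !mnmBE => gi.
    have [iS|iS] := boolP (i \in S); last by move: gi; rewrite !mset_out.
    pose t : J := Sub i iS; have iE : i = val t by [].
    move: gi; rewrite iE !mset_in !inE; have [tj|//] := eqVneq t j.
    have gM : (pmon g <= M)%MM.
      by apply/mnm_lepP=> l; apply: leq_trans (mnm_lepP gle l) _; rewrite mnmBE leq_subr.
    have := nohit g; rewrite /hit gg gM -tj -iE ig /=.
    by case: (t \in T); rewrite ?andbF /=; lia.
  have e := coned_homologous cK KU1.
  rewrite (@hclass_chain M c (coned (K M) c j)) //; first 1 last.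
  - exact: coned_supp.
  - exact: coned_cyclic (@dalive_convex M) cK cc KU1.
  rewrite hclass_chain0; first exact: spanned0.
  by move=> T /KD1; apply: coned_eq0.
(* Last case: [M] is the degree of a label, obtained by dividing off the p_g that divide [M] and
   meet S. *)
pose G : {set I} := [set g : I | (pmon (val g) <= M)%MM].
have hitP g j : hit g j -> exists2 g' : I, g' \in G & val g' = g.
  case/and4P=> gg gM jg _.
  have gS : generating x y g && (lines g :&: S != set0).
    by rewrite gg; apply/set0Pn; exists (val j); rewrite in_setI jg (valP j).
  by exists (Sub g gS); rewrite ?inE.
have GM i : [exists g in G, i \in lines (val g)] -> (0 < M i)%N.
  case/exists_inP=> g; rewrite inE => /mnm_lepP/(_ i) + ig; by rewrite mnmE ig.
pose m : 'X_{1..n} := [multinom (M i - [exists g in G, i \in lines (val g)])%N | i < n].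
have ME : M = deg G m.
  apply/mnmP=> i; rewrite degE mnmE.
  by case: (boolP [exists g in G, _]) => [/GM iM|_]; rewrite ?subn0 ?addn0 // subnK.
have MG g j : g \in G -> hit (val g) j -> m (val j) = 0%N.
  move=> gG /and4P[_ _ jg /eqP M1]; rewrite mnmE M1.
  by rewrite (_ : [exists g0 in G, _]) //; apply/exists_inP; exists g.
(* A line of S in the support of [M] hits an interval of [G], so its exponent 1 drops to 0. If p_g
   divided [m], it would divide [M] and be hit at such a line. *)
have am : admissible S x y m.
  apply/andP; split.
    apply/forall_inP=> i iS; pose t : J := Sub i iS.
    have [M0|Mi] := posnP (M i); first by rewrite mnmE M0.
    have := hit_line t; rewrite Mi /= => /forallPn[g]; rewrite negbK => ht.
    by have [g' g'G g'E] := hitP _ _ ht; apply/eqP/(MG g' t) => //; rewrite g'E.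
  apply/forallP=> g; apply/implyP=> gg; apply/negP => gm.
  have gM : (pmon g <= M)%MM.
    rewrite ME; apply/mnm_lepP=> i; apply: leq_trans (mnm_lepP gm i) _.
    by rewrite degE leq_addr.
  have := hit_gen g; rewrite gg gM /= => /forallPn[j]; rewrite negbK => hj.
  have [g' g'G g'E] := hitP _ _ hj; have := mnm_lepP gm (val j).
  have /and4P[_ _ jg _] := hj; rewrite mnmE jg (MG g' j) //; by rewrite g'E.
pose e : label := ([ffun g => g \in G], m).
have GE : [set g | e.1 g] = G by apply/setP=> g; rewrite inE ffunE.
have KE T : K M T = meets_all (@slines n k S x y) G T by rewrite ME dalive_deg.
have [a [b bK ce]] : exists a : 'F_2,
    homologous (meets_all (@slines n k S x y) G) c (sqz_mon a (ic @: G)).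
  apply: homologous_point (@slines_disjoint _ _ _ _ _) (ic_slines icP) _ _ _.
    by move=> T /cK; rewrite KE.
  by move=> T; rewrite -KE; apply: cc.
have hc : homologous (K M) c (sqz_mon a (ic @: G)).
  by exists b => T; [move=> /bK; rewrite KE | rewrite KE => /ce].
have eE : basis_elt ic e.1 e.2 = phi x y (chain M (sqz_mon 1 (ic @: G))).
  by rewrite basis_eltE // GE; congr (phi x y (chain _ _)).
have [a0|a1] : a = 0 \/ a = 1.
  case: a {ce hc} => -[|[|//]] i; [left | right]; exact: val_inj.
  rewrite (@hclass_chain M c _ cK _ _ hc) a0.
  - rewrite hclass_chain0; first exact: spanned0.
    by move=> T _; rewrite ffunE if_same.
  - by move=> T; rewrite ffunE if_same eqxx.
  by move=> T _; rewrite bdE big1 // => j _; rewrite ffunE if_same.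
exists [:: e]; first by rewrite /= am.
have e1 : ldeg e = M by rewrite /ldeg GE -ME.
have e2 : lpts e = ic @: G by rewrite /lpts GE.
rewrite big_seq1 eE a1 in hc *.
apply: (hclass_chain cK _ _ hc); rewrite -e1 -e2.
  exact: basis_supp.
exact: basis_cyclic.
Qed.

Lemma homology_spanned h : spanned h.
Proof.
have [a Za ->] := hclass_surj h.
have [q qE] : exists q, a = phi x y q by apply: block_phi; case/andP: Za.
have [s us sP] := dcoef_supp q.
move: Za; rewrite qE => /cycles_phi cyc.
rewrite (phi_sum_chain us sP).
have Zr M : M \in s -> phi x y (chain M (restr M q)) \in Z.
  move=> _; apply: chain_cycle; first exact: restr_supp.
  exact: restr_cyclic.
have [_] := hclass_sum (fun=> 1) Zr.
under eq_bigr do rewrite scale1r.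
move=> ->; apply: spanned_sum => M _; rewrite scale1r.
by apply: spanned_chain; [exact: restr_supp | exact: restr_cyclic].
Qed.

(** In the degree of a label [e0], the sum over transversals sees only the coefficient of [e0], and
    it vanishes on boundaries. *)
Lemma basis_free (s : seq label) (c : label -> 'F_2) : uniq s -> all adm s ->
  \sum_(e <- s) c e *: cls (basis_elt ic e.1 e.2) = 0 ->
  forall e, e \in s -> c e = 0.
Proof.
move=> us /allP adms; have Zs e : e \in s -> basis_elt ic e.1 e.2 \in Z.
  by move/adms; apply: basis_cycle.
have [Zsum <-] := hclass_sum c Zs => /(hclass_eq0 Zsum)[w /block_phi[r ->] sumE] e0 e0s.
pose B e : UCpoly S := chain (ldeg e) (sqz_mon 1 (lpts e)).
have {sumE} : phi x y (\sum_(e <- s) B e *+ c e) =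
    phi x y (sqz_diff (fun j : J => 'X_(val j)) r).
  rewrite -dBS_phi -[RHS]sumE raddf_sum; apply: eq_bigr => e _.
  by rewrite raddfMn /= F2_scale basis_eltE.
move/(phi_dcoefP nf)/(_ (ldeg e0)) => E.
have ae0 := adms _ e0s.
pose tr := meets_once (@slines n k S x y) [set g | e0.1 g].
have : \sum_(T | tr T) dcoef (ldeg e0) (\sum_(e <- s) B e *+ c e) T = 0.
  rewrite -[RHS](sum_meets_once_bd (c := dcoef (ldeg e0) r)
    (@slines_disjoint n k S x y) (G := [set g | e0.1 g])).
    (* The equation [E] holds only at surviving sets; transversals are among them. *)
    apply: eq_bigr => T trT; rewrite E ?dcoef_diff // dalive_deg //.
    exact: meets_once_meets.
  move=> T nz; rewrite -(mset_deg _ ae0); apply: contraNT nz => ?.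
  exact/eqP/dcoef_out.
(* The other labels have other degrees and contribute nothing. *)
have dE T : dcoef (ldeg e0) (\sum_(e <- s) B e *+ c e) T = sqz_mon 1 (lpts e0) T *+ c e0.
  rewrite (raddf_sum (dcoef (ldeg e0))) sum_ffunE.
  have BE e : dcoef (ldeg e0) (B e *+ c e) T = dcoef (ldeg e0) (B e) T *+ c e.
    by rewrite (raddfMn (dcoef (ldeg e0))) ffunMnE.
  rewrite (bigD1_seq e0 e0s us) /= [X in X + _]BE.
  rewrite [in X in X *+ _ + _]dcoef_chain_supp; last exact: basis_supp.
  rewrite eqxx big1_seq ?addr0 // => e /andP[ne es].
  rewrite BE dcoef_chain_supp; last by apply: basis_supp; apply: adms.
  case: eqP => [/(ldeg_inj (adms _ es) ae0) e'|_]; first by rewrite e' eqxx in ne.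
  by rewrite ffunE mul0rn.
under eq_bigr => T _ do rewrite dE.
rewrite (bigD1 (lpts e0)) /=; last exact: lpts_meets_once.
rewrite ffunE eqxx big1 ?addr0 => [|T /andP[_ /negbTE Te]].
  by rewrite natr_Zp.
by rewrite ffunE Te mul0rn.
Qed.

End Main.

Theorem theorem1p3 (n k : nat) (S : {set 'I_n}) (hk : (k <= n.+1)%N) :
  direct_sum_complex (@dBS n k S)
    (fun xy : vert n k * vert n k => block S xy.1 xy.2)
  /\
  forall (x y : vert n k) (ic : genS S x y -> {i : 'I_n | i \in S}),
    ~~ far x y ->
    (forall g : genS S x y, val (ic g) \in lines (val g)) ->
    (forall (eps : {ffun genS S x y -> bool}) (m : 'X_{1..n}),
       admissible S x y m ->
       basis_elt ic eps m \in cycles (@dBS n k S) (block S x y)) /\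
    is_basis
      (fun e : {ffun genS S x y -> bool} * 'X_{1..n} => admissible S x y e.2)
      (fun e => hclass (@dBS n k S) (block S x y) (basis_elt ic e.1 e.2)).
Proof.
split=> [|x y ic nf icP]; first exact: direct_sum_blocks.
split=> [eps m am|]; first exact: (basis_cycle nf icP (e := (eps, m))).
split=> [h|s c us sa s0]; last exact: (basis_free nf icP us sa s0).
by have [r ra ->] := homology_spanned nf icP h; apply: sum_span.
Qed.
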